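(* For any positive integer $n$, \[ \sum_{\lambda \in OP(n)} \psi_{S_n}^\lambda = \operatorname{sign} \otimes \sum_{\lambda \in EP(n)} \psi_{S_n}^\lambda , \] where $\operatorname{sign}$ is the sign character of $S_n$.
   Context: $OP(n)$ is the set of all partitions of $n$ with odd parts only. For $n$ even, $EP(n)$ is the set of all partitions of $n$ with even parts only; for $n$ odd, $EP(n)$ is the set of all partitions of $n$ with all parts even except for a single part of size $1$. Higher Lie characters of $S_n$: let $\lambda \vdash n$ have $a_i$ parts of size $i$ ($i\ge 1$), and let $x \in S_n$ have cycle type $\lambda$. Write $x=\prod_i x_i$ where $x_i$ is the product of the $a_i$ cycles of $x$ of length $i$. The centralizer is $Z_x = Z_{S_n}(x) = \prod_i Z_{S_{ia_i}}(x_i) \cong \prod_i G_i \wr S_{a_i}$, with $G_i$ cyclic of order $i$. Concretely, label the $ia_i$ points lying in cycles of length $i$ by $(r,t)$, $1\le r\le a_i$, $t \in \mathbb{Z}/i\mathbb{Z}$, so that $x(r,t)=(r,t+1)$; every element $z_i\in Z_{S_{ia_i}}(x_i)$ has the form $z_i(r,t)=(\sigma(r),t+k_r)$ with $\sigma\in S_{a_i}$, $k_r\in\mathbb{Z}/i\mathbb{Z}$. Let $\omega_i$ be the linear character that is a primitive (faithful) irreducible character on the cyclic group $G_i$ and trivial on $S_{a_i}$, i.e. $\omega_i(z_i)=\prod_r \zeta_i^{k_r}$ with $\zeta_i$ a primitive complex $i$-th root of unity. Let $\omega^x := \bigotimes_i \omega_i$, a linear character of $Z_x$. The higher Lie character is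 the induced character $\psi_{S_n}^\lambda = \psi_{S_n}^x := \omega^x\uparrow_{Z_x}^{S_n}$; it depends only on $\lambda$. *)

(* Defs.v *)
From mathcomp Require Import all_boot all_order all_algebra.
From mathcomp Require Import all_fingroup all_solvable all_field all_character.

Set Implicit Arguments.
Unset Strict Implicit.
Unset Printing Implicit Defensive.

Import GroupScope GRing.Theory.

(* A partition of n is the weakly decreasing sequence of its (positive) parts.
   It has at most n parts, all at most n, so carving these sequences out of
   n.-bseq 'I_n.+1 loses nothing and provides the finType needed to sum. *)
Definition is_intpart (n : nat) (s : seq nat) : bool :=
  [&& sorted geq s, 0 \notin s & sumn s == n].

Definition intpart (n : nat) : predArgType :=
  {lam : n.-bseq 'I_n.+1 | is_intpart n (map val lam)}.

Definition parts (n : nat) (lam : intpart n) : seq nat := map val (val lam).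

Definition OP (n : nat) : {set intpart n} := [set lam | all odd (parts lam)].

Definition EP (n : nat) : {set intpart n} :=
  [set lam | if odd n
             then (count_mem 1%N (parts lam) == 1%N)
                  && all (fun i => (i == 1%N) || ~~ odd i) (parts lam)
             else all (fun i => ~~ odd i) (parts lam)].

Definition cycle_type (n : nat) (x : 'S_n) : seq nat :=
  sort geq [seq #|A| | A : {set 'I_n} in porbits x].

(* A point p = (r,t) of 'I_n is labelled relatively to the base point
   (r,0) = froot x p chosen by the library in the cycle of p: one has
   p = x^t (froot x p) with t = findex x (froot x p) p smaller than the length
   of that cycle. The base points are the elements of froots x. *)
Definition cycle_pos (n : nat) (x : 'S_n) (p : 'I_n) : nat :=
  findex x (froot x p) p.

(* If z commutes with x, then z (r,0) = (sigma r, k_r) with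
   k_r = cycle_pos x (z (r,0)). *)
Definition omega_part (n : nat) (zeta : nat -> algC) (x : 'S_n) (i : nat)
    (z : 'S_n) : algC :=
  (\prod_(b : 'I_n | (b \in froots x) && (#|porbit x b| == i))
     zeta i ^+ cycle_pos x (z b))%R.

Definition omega_fun (n : nat) (zeta : nat -> algC) (x z : 'S_n) : algC :=
  (\prod_(1 <= i < n.+1) omega_part zeta x i z)%R.

Section OmegaMorphism.

Variables (n : nat) (zeta : nat -> algC) (x : 'S_n).
Hypothesis zetaP : forall i, (0 < i)%N -> (i.-primitive_root (zeta i))%R.

Let symx := fconnect_sym (@perm_inj _ x).

Lemma fconnect_porbit (p q : 'I_n) : fconnect x p q = (q \in porbit x p).
Proof.
apply/idP/porbitP => [/iter_findex <-|[i ->]].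
  by exists (findex x p q); rewrite permX.
by rewrite permX fconnect_iter.
Qed.

Lemma order_porbit (p : 'I_n) : fingraph.order x p = #|porbit x p|.
Proof. by apply: eq_card => q; rewrite -fconnect_porbit. Qed.

Lemma findex_iter_mod (c : 'I_n) (m : nat) :
  findex x c (iter m x c) = (m %% #|porbit x c|)%N.
Proof.
have itk k : iter (k * #|porbit x c|)%N x c = c.
  by elim: k => //= k IHk; rewrite mulSn iterD IHk iter_porbit.
rewrite {1}(divn_eq m #|porbit x c|) addnC iterD itk findex_iter //.
by rewrite order_porbit ltn_mod lt0n card_porbit_neq0.
Qed.

Lemma cent1_iter (z : 'S_n) (m : nat) (p : 'I_n) :
  z \in 'C[x] -> z (iter m x p) = iter m x (z p).
Proof.
move/cent1P => czx; elim: m => //= m IHm.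
by rewrite -IHm -!permM czx.
Qed.

Lemma froot_iter (m : nat) (p : 'I_n) : froot x (iter m x p) = froot x p.
Proof. by apply/esym/eqP; rewrite (root_connect symx) fconnect_iter. Qed.

Lemma iter_cycle_pos (p : 'I_n) : iter (cycle_pos x p) x (froot x p) = p.
Proof. by rewrite iter_findex // symx connect_root. Qed.

Lemma froot_cent1 (z : 'S_n) (p : 'I_n) :
  z \in 'C[x] -> froot x (z (froot x p)) = froot x (z p).
Proof.
by move=> Cz; rewrite -{2}(iter_cycle_pos p) cent1_iter // froot_iter.
Qed.

Lemma porbit_froot (p : 'I_n) : porbit x (froot x p) = porbit x p.
Proof.
by apply/esym/eqP; rewrite eq_porbit_mem -fconnect_porbit symx connect_root.
Qed.

Lemma card_porbit_cent1 (z : 'S_n) (p : 'I_n) :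
  z \in 'C[x] -> #|porbit x (z p)| = #|porbit x p|.
Proof.
move=> Cz; rewrite -(card_imset (mem (porbit x p)) (@perm_inj _ z)).
apply: eq_card => q; rewrite -fconnect_porbit.
apply/idP/imsetP => [/iter_findex <-|[q']].
  exists (iter (findex x (z p) q) x p); last by rewrite cent1_iter.
  by rewrite -fconnect_porbit fconnect_iter.
rewrite -fconnect_porbit => /iter_findex <- ->.
by rewrite cent1_iter // fconnect_iter.
Qed.

Lemma cycle_pos_cent1 (z : 'S_n) (p : 'I_n) : z \in 'C[x] ->
  cycle_pos x (z p) =
    ((cycle_pos x (z (froot x p)) + cycle_pos x p) %% #|porbit x p|)%N.
Proof.
move=> Cz; rewrite {1}/cycle_pos -(froot_cent1 p Cz).
rewrite -{2}(iter_cycle_pos p) cent1_iter //.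
rewrite -{2}(iter_cycle_pos (z (froot x p))) -iterD findex_iter_mod addnC.
by rewrite porbit_froot card_porbit_cent1 // porbit_froot.
Qed.

Lemma omega_partM (i : nat) : (0 < i)%N ->
  {in 'C[x] &, {morph omega_part zeta x i : z w / z * w >-> (z * w)%R}}.
Proof.
move=> i_gt0 z w Cz Cw; rewrite /omega_part.
rewrite [X in (_ = _ * X)%R](reindex_onto (fun b => froot x (z b))
          (fun b => froot x (z^-1 b))) /=; last first.
  move=> b /andP[/eqP rb _]; rewrite froot_cent1 //.
  by rewrite permKV rb.
rewrite [X in (_ = _ * X)%R](eq_bigl
  (fun b => (b \in froots x) && (#|porbit x b| == i))); last first.
  move=> b; rewrite porbit_froot card_porbit_cent1 //.
  rewrite froot_cent1 ?groupV // permK !unfold_in.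
  rewrite (root_root symx) eqxx /= andbC.
  by rewrite eqE.
rewrite -big_split /=; apply: eq_bigr => b /andP[_ /eqP ob].
rewrite permM cycle_pos_cent1 // card_porbit_cent1 // ob -exprD.
by rewrite (prim_expr_mod (zetaP i_gt0)) addnC.
Qed.

Lemma omega_funM :
  {in 'C[x] &, {morph omega_fun zeta x : z w / z * w >-> (z * w)%R}}.
Proof.
move=> z w Cz Cw; rewrite /omega_fun -big_split /= !big_nat.
by apply: eq_bigr => i /andP[i_gt0 _]; apply: omega_partM.
Qed.

Lemma omega_fun_neq0 (z : 'S_n) : (omega_fun zeta x z != 0)%R.
Proof.
rewrite /omega_fun big_nat.
apply: (big_ind (fun c : algC => c != 0)%R) => [||i /andP[i_gt0 _]].
- exact: oner_neq0.
- by move=> c d c0 d0; rewrite mulf_neq0.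
apply/prodf_neq0 => b _; rewrite expf_neq0 //.
apply: contra_eq_neq (prim_expr_order (zetaP i_gt0)) => ->.
by rewrite expr0n eqn0Ngt i_gt0 eq_sym oner_neq0.
Qed.

Lemma omega_is_class_fun :
  is_class_fun <<'C[x]>> [ffun z => omega_fun zeta x z *+ (z \in 'C[x])]%R.
Proof.
rewrite genGid; apply: intro_class_fun => [z y Cz Cy | z /negPf-> //].
rewrite groupJ // Cz !mulr1n; apply: (mulfI (omega_fun_neq0 y)).
by rewrite -omega_funM ?groupJ // -conjgC omega_funM // mulrC.
Qed.

End OmegaMorphism.

Definition omega (n : nat) (zeta : nat -> algC)
    (zetaP : forall i, (0 < i)%N -> (i.-primitive_root (zeta i))%R)
    (x : 'S_n) : 'CF('C[x]) :=
  Cfun 0 (omega_is_class_fun x zetaP).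

Lemma sign_is_class_fun (n : nat) :
  is_class_fun <<[set: 'S_n]>> [ffun g : 'S_n => ((-1) ^+ odd_perm g : algC)%R].
Proof.
rewrite genGid; apply: intro_class_fun => [g y _ _ | g]; last by rewrite inE.
by rewrite odd_permJ.
Qed.

Definition sign_cf (n : nat) : 'CF([set: 'S_n]) := Cfun 0 (sign_is_class_fun n).


Section CycleTypeExists.

Variables (n : nat) (ss : seq (seq 'I_n)).
Hypotheses (ssP : flatten ss = enum 'I_n) (ss0 : [::] \notin ss).

Let block (p : 'I_n) : seq 'I_n := nth [::] ss (find (fun c => p \in c) ss).

Let has_block (p : 'I_n) : has (fun c => p \in c) ss.
Proof.
have: p \in flatten ss by rewrite ssP mem_enum.
by case/flattenP=> c ssc pc; apply/hasP; exists c.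
Qed.

Let mem_block (p : 'I_n) : p \in block p.
Proof. exact: (nth_find [::] (has_block p)). Qed.

Let block_ss (p : 'I_n) : block p \in ss.
Proof. by rewrite mem_nth // -has_find has_block. Qed.

Let uniq_flat : uniq (flatten ss).
Proof. by rewrite ssP enum_uniq. Qed.

Let uniq_ss (c : seq 'I_n) : c \in ss -> uniq c.
Proof.
move=> ssc; move: uniq_flat; case/splitPr: ssc => s1 s2.
by rewrite flatten_cat /= !cat_uniq => /and3P[_ _ /and3P[]].
Qed.

Let blockE (c : seq 'I_n) (p : 'I_n) : c \in ss -> p \in c -> block p = c.
Proof.
move=> ssc pc; rewrite /block.
elim: ss uniq_flat ssc => //= d s IHs; rewrite cat_uniq => /and3P[_ nd us].
rewrite inE => /predU1P[<-|sc]; first by rewrite pc.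
case: ifP => [pd|_]; last exact: IHs.
case/hasP: nd; exists p => //.
by apply/flattenP; exists c.
Qed.

Let block_next (p : 'I_n) : block (next (block p) p) = block p.
Proof. by rewrite (blockE (block_ss p)) // mem_next. Qed.

Let block_next_inj : injective (fun p => next (block p) p).
Proof.
move=> p q /= e; have eb: block p = block q by rewrite -block_next e block_next.
by apply: (can_inj (prev_next (uniq_ss (block_ss p)))); rewrite e eb.
Qed.

Let x : 'S_n := perm block_next_inj.

Let porbit_block (p : 'I_n) : porbit x p = [set q in block p].
Proof.
apply/setP=> q; rewrite inE -fconnect_porbit.
apply: fconnect_cycle (mem_block p) q.
apply/(@sub_in_cycle _ (mem (block p)) (frel (next (block p)))).
- move=> r s pr _ /= /eqP <-.
  by rewrite permE /= (blockE (block_ss p) pr).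
- exact/allP.
- exact/cycle_next/uniq_ss/block_ss.
Qed.

Lemma cycle_type_blocks : exists y : 'S_n, perm_eq (cycle_type y) (map size ss).
Proof.
exists x; rewrite perm_sort.
have us: uniq ss.
  elim: ss uniq_flat ss0 => //= d s IHs; rewrite cat_uniq inE negb_or eq_sym.
  case/and3P=> _ nd us /andP[d0 s0]; rewrite IHs // andbT.
  apply: contra nd => sd; case: d d0 sd => // p d _ sd.
  apply/hasP; exists p; last exact: mem_head.
  by apply/flattenP; exists (p :: d); rewrite ?mem_head.
have ->: map size ss = map (fun A : {set 'I_n} => #|A|)
                         [seq [set q in c] | c <- ss].
  rewrite -map_comp; apply/eq_in_map => c ssc /=.
  by rewrite cardsE (card_uniqP (uniq_ss ssc)).
apply/perm_map/uniq_perm; first exact: enum_uniq.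
  rewrite map_inj_in_uniq // => c d ssc ssd /setP e.
  case: c ssc e => [/(negP ss0) //|p c] ssc e.
  by rewrite -(blockE ssc (mem_head p c)) (blockE ssd) // -[_ \in d]inE -e inE mem_head.
move=> A; rewrite mem_enum; apply/imsetP/mapP => [[p _ ->]|[c ssc ->]].
  by exists (block p); rewrite ?porbit_block.
case: c ssc => [/(negP ss0) //|p c] ssc; exists p => //.
by rewrite porbit_block (blockE ssc) ?mem_head.
Qed.

End CycleTypeExists.

Lemma cycle_type_exists (n : nat) (lam : intpart n) :
  exists x : 'S_n, cycle_type x == parts lam.
Proof.
case/and3P: (valP lam); rewrite -/(parts lam) => sl l0 /eqP nl.
have sn: sumn (parts lam) = size (enum 'I_n) by rewrite nl size_enum_ord.
have sh: shape (reshape (parts lam) (enum 'I_n)) = parts lam.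
  by rewrite reshapeKl // sn.
have [||x xl] := @cycle_type_blocks n (reshape (parts lam) (enum 'I_n)).
- by rewrite reshapeKr // sn.
- by apply: contra l0 => h; rewrite -sh; apply/mapP; exists [::].
exists x; apply/eqP; apply: (@sorted_eq _ geq).
- by move=> a b c /= ab bc; apply: leq_trans bc ab.
- by move=> a b /=; rewrite andbC -eqn_leq => /eqP.
- by apply: sort_sorted => a b; apply: leq_total.
- exact: sl.
- by rewrite -[X in perm_eq _ X]sh.
Qed.

Definition perm_of_type (n : nat) (lam : intpart n) : 'S_n :=
  xchoose (cycle_type_exists lam).

Definition higher_Lie (n : nat) (zeta : nat -> algC)
    (zetaP : forall i, (0 < i)%N -> (i.-primitive_root (zeta i))%R)
    (lam : intpart n) : 'CF([set: 'S_n]) :=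
  'Ind[[set: 'S_n], 'C[perm_of_type lam]]%R (omega zetaP (perm_of_type lam)).

(* Main.v *)
Require Import Defs.
From mathcomp Require Import all_boot all_order all_algebra.
From mathcomp Require Import all_fingroup all_solvable all_field all_character.
From mathcomp Require Import zify.

(* Write omega^x for the linear character of C(x). The value at g of the sum of
   the higher Lie characters over a family of cycle types is the sum of
   omega^x(g) over the x in C(g) whose cycle type lies in the family, and
   omega^x(g) is the product of local contributions of the orbits of <x, g>.
   Fix such an orbit, made of e cycles of g of common length N. Multiplying x by
   the powers of one of these g-cycles makes the contribution run exactly once
   through the N-th roots of unity, and the x-cycles in the orbit have length
   e * d, where d is the order of that root. Averaging over these twists, the
   orbit contributes for odd parts as if it were 1 when N is a power of 2 and e,
   d are odd, and 0 otherwise. For even parts and N > 1 it gives the same thing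
   with an extra sign -1, which is the sign of g on the orbit. So both sides
   vanish unless g has 2-power order, and then, up to sign(g), they count the
   elements of C(g) which have odd cycles off the fixed points of g and which, on
   these fixed points, have odd cycles, resp. even ones (except for one fixed
   point if n is odd). The two counts agree by a recursion that removes points
   one by one from their cycles. *)

Set Implicit Arguments.
Unset Strict Implicit.
Unset Printing Implicit Defensive.

Import GRing.Theory Num.Theory.
Local Open Scope ring_scope.

(** * Cycles and return times of two commuting permutations *)

Section Cycles.

Variable n : nat.
Implicit Types (x y : 'S_n) (p q b : 'I_n).

Lemma eq_iter_mod x p j k :
  (iter j x p == iter k x p) = (j == k %[mod #|porbit x p|])%N.
Proof.
have itK m : iter (m %% #|porbit x p|) x p = iter m x p.
  by rewrite -findex_iter_mod iter_findex // fconnect_iter.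
apply/eqP/eqP=> [e|e]; first by rewrite -!findex_iter_mod e.
by rewrite -itK e itK.
Qed.

Lemma eq_iter_dvd x p j : (iter j x p == p) = (#|porbit x p| %| j)%N.
Proof. by rewrite -[X in _ == X]/(iter 0 x p) eq_iter_mod mod0n. Qed.

Lemma mem_porbit_iter x p k : iter k x p \in porbit x p.
Proof. by rewrite -fconnect_porbit fconnect_iter. Qed.

Lemma mem_porbitP x p q :
  reflect (exists k, q = iter k x p) (q \in porbit x p).
Proof.
rewrite -fconnect_porbit; apply: (iffP idP) => [/iter_findex<-|[k ->]].
  by exists (findex x p q).
exact: fconnect_iter.
Qed.

Lemma card_porbit_gt0 x p : (0 < #|porbit x p|)%N.
Proof. by rewrite lt0n card_porbit_neq0. Qed.

Lemma iter_iterC x y p j k : commute x y ->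
  iter j y (iter k x p) = iter k x (iter j y p).
Proof.
move=> cxy; elim: j => //= j ->; apply: cent1_iter.
exact/cent1P.
Qed.

Lemma porbit_iter x p k : porbit x (iter k x p) = porbit x p.
Proof. by apply/eqP; rewrite eq_porbit_mem mem_porbit_iter. Qed.

Lemma mem_porbitC x y p q : commute x y ->
  (y q \in porbit x (y p)) = (q \in porbit x p).
Proof.
move=> cxy; apply/mem_porbitP/mem_porbitP=> -[k e]; exists k.
  by apply: (@perm_inj _ y); rewrite e -(@iter_iterC _ _ _ 1).
by rewrite e -(@iter_iterC _ _ _ 1).
Qed.

Lemma mem_porbit_iterC x y p q j : commute x y ->
  (iter j y q \in porbit x (iter j y p)) = (q \in porbit x p).
Proof. by move=> cxy; elim: j => //= j IHj; rewrite mem_porbitC. Qed.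

Lemma ret_subproof x y b : exists r, (0 < r)%N && (iter r y b \in porbit x b).
Proof.
by exists #|porbit y b|; rewrite card_porbit_gt0 iter_porbit porbit_id.
Qed.

(* First return time of [b] to its own [x]-cycle under the iterates of [y]. *)
Definition ret x y b : nat := ex_minn (ret_subproof x y b).

Lemma ret_gt0 x y b : (0 < ret x y b)%N.
Proof. by rewrite /ret; case: ex_minnP => r /andP[]. Qed.

Lemma ret_mem x y b : iter (ret x y b) y b \in porbit x b.
Proof. by rewrite /ret; case: ex_minnP => r /andP[]. Qed.

Lemma ret_min x y b j :
  (0 < j)%N -> iter j y b \in porbit x b -> (ret x y b <= j)%N.
Proof.
rewrite /ret; case: ex_minnP => r _ rmin j0 jb.
by apply: rmin; rewrite j0.
Qed.

(** Since [y] permutes the [x]-cycles, adding a return time to an exponent does not change whether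
    that exponent is one; Euclidean division by the least return time then leaves remainder 0. *)
Lemma mem_ret x y b j : commute x y ->
  (iter j y b \in porbit x b) = (ret x y b %| j)%N.
Proof.
move=> cxy; set r := ret x y b.
have stepD a c : iter a y b \in porbit x b ->
    (iter (c + a) y b \in porbit x b) = (iter c y b \in porbit x b).
  move/mem_porbitP=> [k e].
  rewrite iterD e iter_iterC // !(porbit_sym _ _ b).
  by rewrite porbit_iter.
have mulr_mem m : iter (m * r) y b \in porbit x b.
  elim: m => [|m IHm]; first by rewrite mul0n porbit_id.
  by rewrite mulSn stepD // ret_mem.
rewrite [in LHS](divn_eq j r) addnC stepD ?mulr_mem // /dvdn.
have [->|j0] := eqVneq (j %% r)%N 0%N; first by rewrite porbit_id.
apply/negP=> /ret_min; rewrite lt0n j0 => /(_ isT).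
by rewrite leqNgt ltn_mod ret_gt0.
Qed.

Lemma ret_dvd_card x y b : commute x y -> (ret x y b %| #|porbit y b|)%N.
Proof. by move=> cxy; rewrite -mem_ret // iter_porbit porbit_id. Qed.

(** The two cycles of [b] meet in the points reached at the multiples of [ret y x b] along the
    [x]-cycle, and of [ret x y b] along the [y]-cycle; the formula equates the two counts of this
    intersection. *)
Lemma card_porbit_ret x y b : commute x y ->
  #|porbit x b| = (ret y x b * (#|porbit y b| %/ ret x y b))%N.
Proof.
move=> cxy; set e := ret y x b; set r := ret x y b; set i := #|_|.
set N := #|_|; set d := (N %/ r)%N.
have cyx : commute y x by [].
have NE : N = (d * r)%N by rewrite divnK // ret_dvd_card.
have e0 : (0 < e)%N by apply: ret_gt0.
have /mem_porbitP[s es] : iter e x b \in porbit y b by apply: ret_mem.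
have itE j : iter (j * e) x b = iter (j * s) y b.
  elim: j => // j IHj; rewrite !mulSn !iterD IHj -iter_iterC //.
  by rewrite es -!iterD addnC.
have rs : (r %| s)%N by rewrite -mem_ret // -es mem_porbit_iter.
apply/eqP; rewrite eqn_dvd; apply/andP; split.
  rewrite -eq_iter_dvd mulnC itE eq_iter_dvd -/N NE.
  by rewrite dvdn_pmul2l // /d divn_gt0 ?ret_gt0 // dvdn_leq ?card_porbit_gt0 // ret_dvd_card.
have /dvdnP[j iE] : (e %| i)%N by apply: ret_dvd_card.
(* Conversely [y^r b] is reached from [b] by a power of [x^e], so [r] is a multiple of [s] modulo
   [N], and [N %| j * s] yields [N %| j * r]. *)
have /mem_porbitP[k kE] : iter r y b \in porbit x b by apply: ret_mem.
have /dvdnP[k' kk] : (e %| k)%N by rewrite -mem_ret // -kE mem_porbit_iter.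
have sk : (k' * s = r %[mod N])%N.
  by apply/eqP; rewrite -eq_iter_mod -itE -kk kE.
have Njs : (N %| j * s)%N by rewrite -eq_iter_dvd -itE -iE iter_porbit.
rewrite iE mulnC dvdn_pmul2r //.
have: (N %| j * r)%N.
  rewrite /dvdn -modnMmr -sk modnMmr mulnCA -modnMmr.
  by rewrite (eqP Njs) muln0 mod0n.
by rewrite NE dvdn_pmul2r ?ret_gt0.
Qed.

End Cycles.

(** * Local weights, and twisting by the powers of one [g]-cycle *)

Section LocalWeight.

Variables (n : nat) (zeta : nat -> algC).
Hypothesis zetaP : forall i, (0 < i)%N -> i.-primitive_root (zeta i).
Implicit Types (x g : 'S_n) (p q b m : 'I_n).

(* The contribution to omega^x(g) of the orbit of [b] under [x] and [g]: if r
   is the least r > 0 with g^r b = x^k b for some k, it is zeta_i ^+ k where i is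
   the length of the [x]-cycle of [b]. *)
Definition local_weight x g b : algC :=
  zeta #|porbit x b| ^+ findex x b (iter (ret x g b) g b).

Lemma local_weightE x g b k : iter k x b = iter (ret x g b) g b ->
  local_weight x g b = zeta #|porbit x b| ^+ k.
Proof.
move=> e; rewrite /local_weight -e findex_iter_mod prim_expr_mod //.
exact/zetaP/card_porbit_gt0.
Qed.

(** If [g^r b = x^k b], then [g^(j * r) b = x^(k * j) b], and this point is [b] exactly when the
    [j]-th power of the weight is 1. This determines the exact order of the weight as a root of
    unity. *)
Lemma local_weight_exp1 x g b j : commute x g ->
  (local_weight x g b ^+ j == 1) = (#|porbit g b| %/ ret x g b %| j)%N.
Proof.
move=> cxg; have /mem_porbitP[k e] := ret_mem x g b.
rewrite (local_weightE (esym e)) -exprM.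
rewrite -(prim_order_dvd (zetaP (card_porbit_gt0 x b))) -eq_iter_dvd.
have ->: iter (k * j) x b = iter (j * ret x g b) g b.
  elim: j => [|j IHj]; first by rewrite muln0.
  by rewrite mulnS mulSn !iterD IHj -iter_iterC // -e -!iterD addnC.
rewrite eq_iter_dvd -{1}(divnK (ret_dvd_card b cxg)).
by rewrite dvdn_pmul2r ?ret_gt0.
Qed.

Definition cycle_part g m : 'S_n := restr_perm (porbit g m) g.

Lemma cycle_part_norm g m : g \in 'N(porbit g m | 'P)%g.
Proof.
rewrite inE; apply/andP; split; first by rewrite inE.
rewrite inE; apply/subsetP=> q qm; rewrite inE /= apermE.
by rewrite -(@porbit_iter _ g m 1) mem_porbitC.
Qed.

Lemma cycle_partE g m p :
  cycle_part g m p = if p \in porbit g m then g p else p.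
Proof.
case: ifP=> [pm|/negbT pm]; first by rewrite restr_permE ?cycle_part_norm.
by apply: out_perm pm; apply: restr_perm_on.
Qed.

Lemma mem_porbit_step g p m : (g p \in porbit g m) = (p \in porbit g m).
Proof. by rewrite -{1}(@porbit_iter _ g m 1) mem_porbitC. Qed.

Lemma cycle_part_commute g m : commute (cycle_part g m) g.
Proof.
apply/permP=> p; rewrite !permM !cycle_partE mem_porbit_step.
by case: ifP.
Qed.

Lemma iter_cycle_part g m t p :
  iter t (cycle_part g m) p = if p \in porbit g m then iter t g p else p.
Proof.
case: ifP=> pm; elim: t => //= t IHt; rewrite IHt cycle_partE ?pm //.
suff ->: iter t g p \in porbit g m by [].
by rewrite -(porbit_iter g m t) mem_porbit_iterC.
Qed.

(** The factor commutes with [g], so twisting preserves the centralizer of [g]; it affects only the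
    points that [x] sends into the [g]-cycle of [m]. *)
Definition twist g m t x : 'S_n := (x * cycle_part g m ^+ t)%g.

Lemma twistE g m t x p :
  twist g m t x p = if x p \in porbit g m then iter t g (x p) else x p.
Proof. by rewrite permM permX iter_cycle_part. Qed.

Lemma twist_commute g m t x : commute x g -> commute (twist g m t x) g.
Proof.
move=> cxg; apply: commute_sym; apply: commuteM; first exact: commute_sym.
by apply/commute_sym/commute_sym/commuteX/commute_sym/cycle_part_commute.
Qed.

Section Twist.

Variables (g x : 'S_n) (m : 'I_n).
Hypothesis cxg : commute x g.

Let e := ret g x m.
Let N := #|porbit g m|.

(** Strictly between time 0 and its first return, the [x]-trajectory of [m] is off the [g]-cycle of
    [m], where alone the twist acts. *)
Lemma iter_twist_lt t j : (j < e)%N -> iter j (twist g m t x) m = iter j x m.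
Proof.
elim: j => //= j IHj je; rewrite IHj ?(ltnW je) // twistE -iterS.
case: ifP=> // /(ret_min (ltn0Sn j)).
by rewrite leqNgt je.
Qed.

Lemma iter_twist_ret t : iter e (twist g m t x) m = iter t g (iter e x m).
Proof.
have e0 : (0 < e)%N by apply: ret_gt0.
rewrite -(prednK e0) !iterS iter_twist_lt ?prednK // twistE -iterS prednK //.
by rewrite ret_mem.
Qed.

Lemma ret_twist t : ret g (twist g m t x) m = e.
Proof.
apply/eqP; rewrite eqn_leq; apply/andP; split.
  apply: ret_min; first exact: ret_gt0.
  have /mem_porbitP[k ke] := ret_mem g x m.
  by rewrite iter_twist_ret ke -iterD mem_porbit_iter.
rewrite leqNgt; apply/negP=> lt_e.
have := ret_mem g (twist g m t x) m; rewrite iter_twist_lt //.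
by move=> /(ret_min (ret_gt0 _ _ _)); rewrite leqNgt lt_e.
Qed.

Let V t := local_weight (twist g m t x) g m.

Lemma card_porbit_twist t :
  #|porbit (twist g m t x) m| = (e * (N %/ ret (twist g m t x) g m))%N.
Proof. by rewrite (@card_porbit_ret _ _ g) ?ret_twist //; apply: twist_commute. Qed.

Lemma local_weight_twist_unity t : V t ^+ N = 1.
Proof.
have cy := twist_commute m t cxg.
by apply/eqP; rewrite local_weight_exp1 // dvdn_div // ret_dvd_card.
Qed.

(** The order of the weight gives the return time [r], hence the length of the twisted cycle and the
    exponent [k] modulo it. As [e] steps of the twisted permutation move [m] by [t + s] along its
    [g]-cycle, [(k / e) * (t + s) = r] modulo [N], which pins down [t]. With
    [local_weight_twist_unity], the weights run exactly once through the [N]-th roots of unity. *)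
Lemma local_weight_twist_inj t1 t2 :
  V t1 = V t2 -> (t1 = t2 %[mod N])%N.
Proof.
move=> V12; pose y t := twist g m t x; pose r t := ret (y t) g m.
have cy t : commute (y t) g by apply: twist_commute.
have rN t : (r t %| N)%N by apply: ret_dvd_card.
have N0 : (0 < N)%N by apply: card_porbit_gt0.
have r0 t : (0 < r t)%N by apply: ret_gt0.
have d12 : (N %/ r t1 = N %/ r t2)%N.
  have VdE t j : (V t ^+ j == 1) = (N %/ r t %| j)%N by apply: (local_weight_exp1 _ _ (cy t)).
  apply/eqP; rewrite eqn_dvd -(VdE t1) -(VdE t2).
  by rewrite -/(V t1) V12 (VdE t2) dvdnn /= -V12 (VdE t1) dvdnn.
have r12 : r t1 = r t2.
  apply/eqP; rewrite -(@eqn_pmul2l (N %/ r t1)%N).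
    by rewrite divnK // d12 divnK.
  by rewrite divn_gt0 // dvdn_leq.
have i12 : #|porbit (y t1) m| = #|porbit (y t2) m|.
  by rewrite !card_porbit_twist d12.
have /mem_porbitP[k1 k1E] : iter (r t1) g m \in porbit (y t1) m by apply: ret_mem.
have /mem_porbitP[k k2E] : iter (r t2) g m \in porbit (y t2) m by apply: ret_mem.
have k1k : (k1 = k %[mod #|porbit (y t1) m|])%N.
  have := V12; rewrite /V (local_weightE (esym k1E)) (local_weightE (esym k2E)).
  rewrite -i12; move/eqP.
  by rewrite (eq_prim_root_expr (zetaP (card_porbit_gt0 _ _))) => /eqP.
have kE1 : iter k (y t1) m = iter (r t1) g m.
  by rewrite k1E; apply/eqP; rewrite eq_iter_mod k1k.
(* [s] is the shift made by the first return of the untwisted [x]. *)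
have /mem_porbitP[s sE] : iter e x m \in porbit g m by apply: ret_mem.
have yE t : iter e (y t) m = iter (t + s) g m by rewrite iter_twist_ret sE iterD.
have yjE t j : iter (j * e) (y t) m = iter (j * (t + s)) g m.
  elim: j => // j IHj; rewrite !mulSn !iterD IHj -iter_iterC //.
  by rewrite yE -!iterD addnC.
have /dvdnP[k' kk] : (e %| k)%N.
  rewrite -(ret_twist t1) -(mem_ret _ _ (commute_sym (cy t1))) kE1.
  exact: mem_porbit_iter.
have eq1 : (k' * (t1 + s) = r t1 %[mod N])%N.
  by apply/eqP; rewrite -eq_iter_mod -yjE -kk kE1.
have eq2 : (k' * (t2 + s) = r t1 %[mod N])%N.
  by apply/eqP; rewrite -eq_iter_mod -yjE -kk r12 k2E.
have rs t : (r t %| t + s)%N.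
  by rewrite -mem_ret // -yE mem_porbit_iter.
have NE : N = (N %/ r t1 * r t1)%N by rewrite divnK.
have /dvdnP[s1 s1E] := rs t1; have := rs t2; rewrite -r12 => /dvdnP[s2 s2E].
set d := (N %/ r t1)%N in NE.
have red a c : (a * r t1 = c * r t1 %[mod N])%N -> (a = c %[mod d])%N.
  by rewrite NE -!muln_modl => /eqP; rewrite eqn_pmul2r // => /eqP.
(* Divided by [r t1], both shifts become inverses of [k'] modulo [d], hence agree. *)
have f1 : (k' * s1 = 1 %[mod d])%N by apply: red; rewrite mul1n -mulnA -s1E.
have f2 : (k' * s2 = 1 %[mod d])%N by apply: red; rewrite mul1n -mulnA -s2E.
have s12 : (s1 = s2 %[mod d])%N.
  rewrite -[s1]mul1n -modnMml -f2 modnMml mulnAC -modnMml f1 modnMml.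
  by rewrite mul1n.
apply/eqP; rewrite -(eqn_modDr s) s1E s2E NE -!muln_modl; by rewrite s12.
Qed.

End Twist.

End LocalWeight.

(** * Sums over roots of unity *)

Section UnityRoots.

Variables (N : nat) (W : nat -> algC).
Hypotheses (N_gt0 : (0 < N)%N) (WN : forall t, W t ^+ N = 1).
Hypothesis W_inj : forall t u, W t = W u -> (t = u %[mod N])%N.

Let s := [seq W t | t <- iota 0 N].

Let s_uniq : uniq s.
Proof.
rewrite map_inj_in_uniq ?iota_uniq // => t u.
by rewrite !mem_iota /= => tN uN /W_inj; rewrite !modn_small.
Qed.

Let mem_s w : (w \in s) = (w ^+ N == 1).
Proof.
have s_all : all N.-unity_root s.
  by apply/allP=> _ /mapP[t _ ->]; rewrite unity_rootE WN.
have := mem_unity_roots N_gt0 s_all s_uniq; rewrite size_map size_iota.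
by move=> /(_ erefl w) <-; rewrite -unity_rootE.
Qed.

Let sum_s (F : algC -> algC) : \sum_(t < N) F (W t) = \sum_(w <- s) F w.
Proof. by rewrite big_map -(big_mkord xpredT (fun t => F (W t))) /index_iota subn0. Qed.

(** Only the [M]-th roots of unity survive in the sum, and multiplication by a primitive one, [z],
    permutes them; so the sum satisfies [S = z * S] and vanishes when [z != 1]. *)
Lemma sum_unity_torsion M : (M %| N)%N ->
  \sum_(t < N) (W t ^+ M == 1)%:R * W t = (M == 1%N)%:R.
Proof.
move=> MN; have M0 : (0 < M)%N by apply: dvdn_gt0 MN.
rewrite (sum_s (fun w => (w ^+ M == 1)%:R * w)).
have [M1|M1] := eqVneq M 1%N.
  rewrite M1.
  under eq_bigr => w _ do rewrite expr1.
  have s1 : 1 \in s by rewrite mem_s expr1n.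
  rewrite (bigD1_seq _ s1 s_uniq) /= eqxx mul1r big1 ?addr0 // => w /negPf->.
  by rewrite mul0r.
have [z zP] : {z : algC | M.-primitive_root z} by apply: C_prim_root_exists.
have zN : z ^+ N = 1 by case/dvdnP: MN => k ->; rewrite mulnC exprM (prim_expr_order zP) expr1n.
set S := \sum_(w <- s) _.
have zS : S = z * S.
  rewrite {1}/S (perm_big [seq z * w | w <- s]) /=.
    rewrite big_map mulr_sumr; apply: eq_bigr => w _.
    by rewrite exprMn (prim_expr_order zP) mul1r mulrCA.
  have z0 : z != 0.
    apply: contra_eq_neq (prim_expr_order zP) => ->.
    by rewrite expr0n eqn0Ngt M0 eq_sym oner_neq0.
  apply: uniq_perm => //; first by rewrite map_inj_uniq //; apply: mulfI.
  move=> w; rewrite mem_s; apply/idP/mapP=> [|[u]].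
    move/eqP=> wN.
    exists (z^-1 * w); last by rewrite mulVKf.
    by rewrite mem_s exprMn exprVn zN wN invr1 mulr1.
  by rewrite mem_s => /eqP uN ->; rewrite exprMn zN uN mulr1.
have: (1 - z) * S = 0 by rewrite mulrBl mul1r -zS subrr.
move/eqP; rewrite mulf_eq0 subr_eq0 eq_sym -[z]expr1 -(prim_order_dvd zP).
by rewrite dvdn1 (negPf M1) => /eqP.
Qed.

Lemma sum_unity_eq1 : \sum_(t < N) (W t == 1)%:R = 1 :> algC.
Proof.
rewrite -[RHS](sum_unity_torsion (dvd1n N)); apply: eq_bigr => t _.
by rewrite expr1; have [->|] := eqVneq; rewrite ?mulr1 ?mul0r.
Qed.

End UnityRoots.

Lemma pnat2_oddpart N : (0 < N)%N -> (2%N.-nat N) = (N`_2%N^' == 1)%N.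
Proof.
by move=> N0; rewrite partn_eq1 // pnatNK.
Qed.

(** Turns the parity of the order of a weight into a torsion condition, to which [sum_unity_torsion]
    applies. *)
Lemma dvdn_oddpart N d : (0 < N)%N -> (d %| N)%N -> odd d = (d %| N`_2%N^')%N.
Proof.
move=> N0 dN; have d0 : (0 < d)%N by apply: dvdn_gt0 dN.
apply/idP/idP=> [od|h].
  by rewrite -[d](@part_pnat_id 2%N^') ?partn_dvd // -odd_2'nat.
apply: dvdn_odd h _.
by rewrite odd_2'nat part_pnat.
Qed.

(** * Averages of the local weight over all twists *)

Section LocalAverages.

Variables (n : nat) (zeta : nat -> algC).
Hypothesis zetaP : forall i, (0 < i)%N -> i.-primitive_root (zeta i).
Variables (g x : 'S_n) (m : 'I_n).
Hypothesis cxg : commute x g.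

Let e := ret g x m.
Let N := #|porbit g m|.
Let V t := local_weight zeta (twist g m t x) g m.
Let odd_cycle t := odd #|porbit (twist g m t x) m|.

Let N_gt0 : (0 < N)%N.
Proof. exact: card_porbit_gt0. Qed.

Let VN t : V t ^+ N = 1.
Proof. exact: local_weight_twist_unity. Qed.

Let V_inj t u : V t = V u -> (t = u %[mod N])%N.
Proof. exact: local_weight_twist_inj. Qed.

(** The cycle length is [e] times the order of [V t], and that order is odd exactly when it divides
    the odd part of [N]. *)
Let odd_cycleE t : odd_cycle t = odd e && (V t ^+ N`_2%N^' == 1).
Proof.
have cyg := twist_commute m t cxg.
rewrite /odd_cycle (card_porbit_twist m cxg) oddM; congr (_ && _).
rewrite (local_weight_exp1 zetaP _ _ cyg); apply: dvdn_oddpart => //.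
by rewrite dvdn_div // ret_dvd_card.
Qed.

(** For [e] odd, the left side sums the roots of unity whose order divides the odd part of [N]: it
    is 0 unless that part is 1, and then the only nonzero term on either side comes from the twist
    with [V t = 1]. *)
Lemma sum_odd_local_weight :
  \sum_(t < N) (odd_cycle t)%:R * V t =
  \sum_(t < N) (2%N.-nat N && odd_cycle t)%:R.
Proof.
have [oe|ee] := boolP (odd e); last first.
  by rewrite !big1 // => t _; rewrite odd_cycleE (negPf ee) ?andbF ?mul0r.
under eq_bigr => t _ do rewrite odd_cycleE oe /=.
rewrite (sum_unity_torsion N_gt0 VN V_inj (dvdn_part _ _)) -pnat2_oddpart //.
have [N2|_] := boolP (2%N.-nat N); last by rewrite big1.
rewrite /= -[LHS](sum_unity_eq1 N_gt0 VN V_inj); apply: eq_bigr => t _.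
by move: N2; rewrite odd_cycleE oe pnat2_oddpart //= => /eqP->; rewrite expr1.
Qed.

(** For [N > 1] all the [N]-th roots of unity sum to 0, so the even terms give minus the odd ones;
    when [N] is a power of 2 and [e] is odd, [(-1) ^+ (N.+1 * e)] is this -1. For [N = 1] the weight
    and the sign are 1, and the comparison with [N != 1] selects the even cycles. *)
Lemma sum_even_local_weight :
  \sum_(t < N) (~~ odd_cycle t)%:R * V t =
  \sum_(t < N) (2%N.-nat N && (odd_cycle t == (N != 1%N)))%:R
                 * (-1) ^+ (N.+1 * e).
Proof.
have [N1|N1] := eqVneq N 1%N.
  apply: eq_bigr => -[t _] _ /=.
  have -> : V t = 1 by rewrite -[V t]expr1 -{1}N1 VN.
  by rewrite N1 /= eqbF_neg mul2n -signr_odd odd_double.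
have -> : \sum_(t < N) (~~ odd_cycle t)%:R * V t
        = \sum_(t < N) V t - \sum_(t < N) (odd_cycle t)%:R * V t.
  rewrite -sumrB; apply: eq_bigr => t _.
  by case: odd_cycle; rewrite ?mul1r ?mul0r ?subrr ?subr0.
have -> : \sum_(t < N) V t = 0.
  rewrite -[RHS](_ : (N == 1%N)%:R = 0); last by rewrite (negPf N1).
  rewrite -(sum_unity_torsion N_gt0 VN V_inj (dvdnn N)).
  by apply: eq_bigr => t _; rewrite VN eqxx mul1r.
rewrite sub0r sum_odd_local_weight -sumrN; apply: eq_bigr => t _.
rewrite eqb_id; have [/andP[N2 ot]|_] := boolP (_ && _); last by rewrite mul0r oppr0.
rewrite -signr_odd oddM; move: ot; rewrite odd_cycleE => /andP[-> _].
have [k Nk] := p_natP N2; rewrite /= andbT.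
case: k Nk => [/eqP|k ->]; first by rewrite (negPf N1).
by rewrite oddX /= mul1r expr1.
Qed.

End LocalAverages.

(** * Orbits of the group generated by [x] and [g] *)

Section Components.

Variable n : nat.
Implicit Types (x y g : 'S_n) (p q b m : 'I_n).

(** Backward arrows are included to make the relation symmetric, so that [connect] is an
    equivalence. *)
Definition edge x g : rel 'I_n :=
  fun p q => [|| q == x p, p == x q, q == g p | p == g q].

Definition same_comp x g : rel 'I_n := connect (edge x g).

Lemma same_comp_sym x g : connect_sym (edge x g).
Proof.
apply: sym_connect_sym => p q; rewrite /edge.
by do 4![case: (_ == _)].
Qed.

Lemma same_compC x g : same_comp x g =2 same_comp g x.
Proof.
move=> p q; apply: eq_connect => p' q'; rewrite /edge.
by do 4![case: (_ == _)].
Qed.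

Lemma same_comp_step x g p : same_comp x g p (x p).
Proof. by apply: connect1; rewrite /edge eqxx. Qed.

Lemma same_comp_stepr x g p : same_comp x g p (g p).
Proof. by apply: connect1; rewrite /edge eqxx !orbT. Qed.

Lemma same_comp_iter x g p j k : same_comp x g p (iter j x (iter k g p)).
Proof.
apply: (@connect_trans _ _ (iter k g p)).
  elim: k => [|k IHk]; first exact: connect0.
  exact: connect_trans IHk (same_comp_stepr _ _ _).
elim: j => [|j IHj]; first exact: connect0.
exact: connect_trans IHj (same_comp_step _ _ _).
Qed.

Lemma same_comp_porbit x g p q : q \in porbit x p -> same_comp x g p q.
Proof. by case/mem_porbitP=> j ->; apply: (same_comp_iter x g p j 0). Qed.

Lemma same_comp_porbitr x g p q : q \in porbit g p -> same_comp x g p q.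
Proof. by case/mem_porbitP=> j ->; apply: (same_comp_iter x g p 0 j). Qed.

(** Backward steps become forward ones along a finite cycle, and commutation gathers the [x]-steps
    after the [g]-steps. *)
Lemma same_compP x g p q : commute x g ->
  reflect (exists j k, q = iter j x (iter k g p)) (same_comp x g p q).
Proof.
move=> cxg; apply: (iffP idP) => [|[j [k ->]]]; last exact: same_comp_iter.
case/connectP=> s; elim: s p => [|r s IHs] p /=.
  by move=> _ ->; exists 0%N, 0%N.
case/andP=> pr sP lq; have [j [k ->]] := IHs r sP lq.
have [j' [k' ->]] : exists j' k', r = iter j' x (iter k' g p).
  case/or4P: pr => /eqP e.
  - by exists 1%N, 0%N.
  - have : r \in porbit x p by rewrite porbit_sym e (mem_porbit_iter x r 1).
    by case/mem_porbitP=> a ->; exists a, 0%N.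
  - by exists 0%N, 1%N.
  - have : r \in porbit g p by rewrite porbit_sym e (mem_porbit_iter g r 1).
    by case/mem_porbitP=> a ->; exists 0%N, a.
exists (j + j')%N, (k + k')%N.
by rewrite (iter_iterC _ _ _ cxg) -!iterD.
Qed.

Lemma same_comp_sub x y g p q :
  (forall r, same_comp y g r (x r)) -> same_comp x g p q -> same_comp y g p q.
Proof.
move=> yx; move: p q; apply: connect_sub => p q /or4P[] /eqP->.
- exact: yx.
- by rewrite same_comp_sym; apply: yx.
- exact: same_comp_stepr.
- by rewrite same_comp_sym; apply: same_comp_stepr.
Qed.

Lemma same_comp_twist g m t x p q :
  same_comp (twist g m t x) g p q = same_comp x g p q.
Proof.
have tw r : twist g m t x r \in porbit g (x r).
  by rewrite twistE; case: ifP => _; rewrite ?porbit_id ?mem_porbit_iter.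
apply/idP/idP; apply: same_comp_sub => r.
  by apply: connect_trans (same_comp_step _ _ _) (same_comp_porbitr _ (tw r)).
apply: connect_trans (same_comp_step _ _ _) _.
by rewrite -/(same_comp _ _ _ _) same_comp_porbitr // porbit_sym.
Qed.

(** [fingraph.root] depends only on the component as a set, which twisting does not alter; hence the
    same representatives serve for all twists. *)
Lemma same_comp_root_twist g m t x b :
  fingraph.root (edge (twist g m t x) g) b = fingraph.root (edge x g) b.
Proof.
by congr odflt; apply: eq_pick => p; apply: same_comp_twist.
Qed.

Lemma roots_twist g m t x :
  fingraph.roots (edge (twist g m t x) g) =i fingraph.roots (edge x g).
Proof. by move=> b; rewrite !unfold_in same_comp_root_twist. Qed.

Lemma roots_same_comp x g b c :
  b \in fingraph.roots (edge x g) -> c \in fingraph.roots (edge x g) ->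
  same_comp x g b c = (b == c).
Proof.
move=> /eqP rb /eqP rc.
by rewrite /same_comp -(root_connect (same_comp_sym x g)) rb rc.
Qed.

Lemma iter_twist_off g m t x b j :
  ~~ same_comp x g m b -> iter j (twist g m t x) b = iter j x b.
Proof.
move=> mb; elim: j => //= j IHj; rewrite IHj twistE -iterS.
case: ifP => // /(same_comp_porbitr x) h; case/negP: mb.
apply: connect_trans h _.
by rewrite same_comp_sym; apply: (same_comp_iter x g b j.+1 0).
Qed.

Section Agree.

Variables (x y : 'S_n) (b : 'I_n).
Hypothesis xyb : forall j, iter j y b = iter j x b.

Lemma eq_porbit_iter : porbit y b = porbit x b.
Proof.
apply/setP=> q; apply/mem_porbitP/mem_porbitP=> -[k ->]; exists k => //.
Qed.

Lemma eq_ret_iter g : ret y g b = ret x g b.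
Proof.
have pE := eq_porbit_iter; apply/eqP; rewrite eqn_leq.
apply/andP; split; apply: ret_min (ret_gt0 _ _ _) _.
  by rewrite pE ret_mem.
by rewrite -pE ret_mem.
Qed.

Lemma eq_local_weight_iter zeta g :
  (forall i, (0 < i)%N -> i.-primitive_root (zeta i)) ->
  local_weight zeta y g b = local_weight zeta x g b.
Proof.
move=> zetaP; have /mem_porbitP[k kE] := ret_mem x g b.
rewrite (local_weightE zetaP (esym kE)) -eq_porbit_iter.
by apply: local_weightE; rewrite // xyb eq_ret_iter.
Qed.

End Agree.

(** The points [g^j b] with [j] below the return time lie in distinct [x]-cycles and, by reducing
    exponents modulo [ret x g b], they meet every [x]-cycle of the component. *)
Lemma prod_component x g b (F : 'I_n -> algC) : commute x g ->
  \prod_(c in froots x | same_comp x g b c) F c =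
  \prod_(j < ret x g b) F (froot x (iter j g b)).
Proof.
move=> cxg; set r := ret x g b.
have symx := fconnect_sym (@perm_inj _ x).
have frootE p q : (froot x p == froot x q) = (q \in porbit x p).
  by rewrite (root_connect symx) fconnect_porbit.
rewrite -(big_imset F (A := 'I_r) (h := fun j : 'I_r => froot x (iter j g b))) /=.
  apply: eq_bigl => c; apply/andP/imsetP=> [[/eqP rc bc]|[j _ ->]].
    have [a [l cE]] := same_compP _ _ cxg bc.
    have lr : (l %% r < r)%N by rewrite ltn_mod ret_gt0.
    exists (Ordinal lr) => //=; rewrite -rc cE froot_iter; apply/eqP.
    rewrite eq_sym frootE {1}(divn_eq l r) addnC iterD mem_porbit_iterC //.
    by rewrite mem_ret // dvdn_mull.
  split; first by rewrite unfold_in /= (root_root symx).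
  apply: connect_trans (same_comp_iter x g b 0 j) _.
  by apply: same_comp_porbit; rewrite -frootE (root_root symx).
have inj_le (j k : 'I_r) : (j <= k)%N ->
    froot x (iter j g b) = froot x (iter k g b) -> j = k.
  move=> jk /eqP; rewrite frootE -(subnKC jk) iterD mem_porbit_iterC //.
  rewrite mem_ret // => rd; apply/val_inj/eqP; rewrite eqn_leq jk /=.
  rewrite -subn_eq0; apply/eqP; have [//|d0] := posnP (k - j)%N.
  have := dvdn_leq d0 rd; rewrite leqNgt (leq_ltn_trans (leq_subr _ _)) //.
move=> j k _ _; case: (leqP j k) => [|/ltnW] jk e; first exact: inj_le.
by apply/esym/inj_le.
Qed.

Lemma prod_components x g (F : 'I_n -> algC) :
  \prod_(c in froots x) F c =
  \prod_(b in fingraph.roots (edge x g)) \prod_(c in froots x | same_comp x g b c) F c.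
Proof.
have syme := same_comp_sym x g.
rewrite (partition_big (fingraph.root (edge x g)) (mem (fingraph.roots (edge x g)))) /=; last first.
  by move=> c _; rewrite unfold_in /= (root_root syme).
apply: eq_bigr => b /eqP rb; apply: eq_bigl => c; congr (_ && _).
by rewrite eq_sym -{1}rb (root_connect syme).
Qed.

Lemma sum_twist g m t (F : 'S_n -> algC) :
  \sum_(x in 'C[g]%g) F (twist g m t x) = \sum_(x in 'C[g]%g) F x.
Proof.
rewrite [RHS](reindex_inj (mulIg (cycle_part g m ^+ t)%g)).
apply: eq_bigl => x; rewrite groupMr // groupX //; apply/cent1P.
by have e := cycle_part_commute g m; rewrite /commute e.
Qed.

(* Components are switched from [phi] to [phi'] one at a time, in the order of
   their roots, averaging each time over the twists along the cycle of the root. *)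
Lemma sum_prod_components g (phi phi' : 'S_n -> 'I_n -> algC) :
    (forall x m b t, commute x g -> ~~ same_comp x g m b ->
       phi (twist g m t x) b = phi x b /\ phi' (twist g m t x) b = phi' x b) ->
    (forall x m, commute x g ->
       \sum_(t < #|porbit g m|) phi (twist g m t x) m =
       \sum_(t < #|porbit g m|) phi' (twist g m t x) m) ->
  \sum_(x in 'C[g]%g) \prod_(b in fingraph.roots (edge x g)) phi x b =
  \sum_(x in 'C[g]%g) \prod_(b in fingraph.roots (edge x g)) phi' x b.
Proof.
move=> local avg.
(* Hybrid products: the roots numbered below [k] already carry [phi']. *)
pose w k x b := if (b < k)%N then phi' x b else phi x b.
pose f k x := \prod_(b in fingraph.roots (edge x g)) w k x b.
suff step k : (k <= n)%N ->
    \sum_(x in 'C[g]%g) f 0%N x = \sum_(x in 'C[g]%g) f k x.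
  transitivity (\sum_(x in 'C[g]%g) f 0%N x); first exact: eq_bigr.
  rewrite (step n) //; apply: eq_bigr => x _; apply: eq_bigr => b _.
  by rewrite /w ltn_ord.
elim: k => // k IHk kn; rewrite IHk ?(ltnW kn) // {IHk}.
pose m := Ordinal kn; set N := #|porbit g m|.
have N0 : N%:R != 0 :> algC by rewrite pnatr_eq0 card_porbit_neq0.
(* Each twist permutes the centralizer, so [N] copies of a sum make one sum over all twists. *)
have NE F : (\sum_(x in 'C[g]%g) F x) * N%:R
    = \sum_(x in 'C[g]%g) \sum_(t < N) F (twist g m t x) :> algC.
  rewrite exchange_big /= [RHS](eq_bigr (fun=> \sum_(x in 'C[g]%g) F x)).
    by rewrite big_const_ord iter_addr_0 mulr_natr.
  by move=> t _; rewrite (sum_twist g m t F).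
apply: (mulIf N0); rewrite !NE; apply: eq_bigr => x /cent1P cxg.
have fE j t : f j (twist g m t x) =
    \prod_(b in fingraph.roots (edge x g)) w j (twist g m t x) b.
  exact: eq_bigl (roots_twist g m t x).
have wE b : b != m -> w k.+1^~ b =1 w k^~ b.
  by move=> bm y; rewrite /w ltnS leq_eqVlt -[k]/(val m) (inj_eq val_inj) (negPf bm).
have [mr|mr] := boolP (m \in fingraph.roots (edge x g)); last first.
  apply: eq_bigr => t _; rewrite !fE; apply: eq_bigr => b br.
  by rewrite wE //; apply: contraNneq mr => <-.
(* The other components do not see the twist, so [rest] is a common factor of all its values. *)
pose rest := \prod_(b in fingraph.roots (edge x g) | b != m) w k x b.
have wlocal b t : b \in fingraph.roots (edge x g) -> b != m ->
    w k (twist g m t x) b = w k x b.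
  move=> br bm; have nmb : ~~ same_comp x g m b.
    by rewrite roots_same_comp // eq_sym.
  by rewrite /w; have [-> ->] := local x m b t cxg nmb.
have f0 t : f k (twist g m t x) = phi (twist g m t x) m * rest.
  rewrite fE (bigD1 m) //= {1}/w ltnn; congr (_ * _).
  by apply: eq_bigr => b /andP[br bm]; apply: wlocal.
have f1 t : f k.+1 (twist g m t x) = phi' (twist g m t x) m * rest.
  rewrite fE (bigD1 m) //= {1}/w ltnSn; congr (_ * _).
  by apply: eq_bigr => b /andP[br bm]; rewrite wE //; apply: wlocal.
under eq_bigr => t _ do rewrite f0.
under [RHS]eq_bigr => t _ do rewrite f1.
by rewrite -!mulr_suml avg.
Qed.

End Components.

(** * The linear character as a product of local weights *)

Section Omega.

Variables (n : nat) (zeta : nat -> algC).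
Hypothesis zetaP : forall i, (0 < i)%N -> i.-primitive_root (zeta i).
Implicit Types (x z g s : 'S_n) (p q b c : 'I_n).

(* omega^x(z) = \prod_c label x (z c) / label x c over one point c per x-cycle,
   whichever points are chosen. *)
Definition label x p : algC := zeta #|porbit x p| ^+ cycle_pos x p.

Lemma label_neq0 x p : label x p != 0.
Proof.
have i0 := card_porbit_gt0 x p; rewrite expf_neq0 //.
apply: contra_eq_neq (prim_expr_order (zetaP i0)) => ->.
by rewrite expr0n eqn0Ngt i0 eq_sym oner_neq0.
Qed.

Lemma label_iter x p k : label x (iter k x p) = zeta #|porbit x p| ^+ k * label x p.
Proof.
rewrite /label porbit_iter /cycle_pos froot_iter.
have -> : iter k x p = iter (k + cycle_pos x p) x (froot x p).
  by rewrite iterD iter_cycle_pos.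
rewrite findex_iter_mod porbit_froot -exprD.
by rewrite prim_expr_mod //; apply/zetaP/card_porbit_gt0.
Qed.

Lemma label_froot x z p : commute x z ->
  label x (z (froot x p)) = label x (z p) / label x p.
Proof.
move/commute_sym/cent1P=> Cz; apply: (canRL (mulfK (label_neq0 x p))).
rewrite /label (cycle_pos_cent1 p Cz) !card_porbit_cent1 // porbit_froot.
by rewrite prim_expr_mod ?exprD //; apply/zetaP/card_porbit_gt0.
Qed.

Lemma omega_fun_label x z : commute x z ->
  omega_fun zeta x z = \prod_(c in froots x) label x (z c).
Proof.
move=> cxz; rewrite /omega_fun /omega_part.
rewrite (exchange_big_dep (mem (froots x))) /=; last by move=> i c _ /andP[].
apply: eq_bigr => c rc; rewrite /label card_porbit_cent1; last exact/cent1P/commute_sym.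
under eq_bigl => i do rewrite rc andTb eq_sym.
by rewrite big_nat1_eq card_porbit_gt0 ltnS -[X in (_ <= X)%N]card_ord max_card.
Qed.

(** Iterating [g] from [b] visits the [x]-cycles of the component once each, and the quotients of
    labels telescope to [label x (g^r b) / label x b]; as [g^r b = x^k b], this is the local
    weight. *)
Lemma omega_fun_local x g : commute x g ->
  omega_fun zeta x g =
  \prod_(b in fingraph.roots (edge x g)) local_weight zeta x g b.
Proof.
move=> cxg; rewrite omega_fun_label // (prod_components x g).
apply: eq_bigr => b _; rewrite prod_component //.
have /mem_porbitP[k kE] := ret_mem x g b.
rewrite (local_weightE zetaP (esym kE)).
under eq_bigr => j _ do rewrite label_froot // -iterS.
have tel r : \prod_(j < r) (label x (iter j.+1 g b) / label x (iter j g b))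
    = label x (iter r g b) / label x b.
  elim: r => [|r IHr]; first by rewrite big_ord0 divff ?label_neq0.
  by rewrite big_ord_recr /= IHr mulrC mulrA divfK ?label_neq0.
by rewrite tel kE label_iter mulfK ?label_neq0.
Qed.

Lemma iter_conj x s p k : iter k (x ^ s)%g (s p) = s (iter k x p).
Proof. by elim: k => //= k ->; rewrite permJ. Qed.

Lemma card_porbit_conj x s p : #|porbit (x ^ s)%g (s p)| = #|porbit x p|.
Proof.
apply/eqP; rewrite eqn_dvd -!eq_iter_dvd iter_conj (inj_eq (@perm_inj _ s)).
rewrite iter_porbit eqxx /= -(inj_eq (@perm_inj _ s)) -iter_conj.
by rewrite iter_porbit.
Qed.

Lemma froot_conj x s p : froot (x ^ s)%g (s (froot x p)) = froot (x ^ s)%g (s p).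
Proof.
by rewrite -[in RHS](iter_cycle_pos x p) -iter_conj froot_iter.
Qed.

Lemma froot_id x b : (b \in froots x) = (froot x b == b).
Proof. by []. Qed.

Lemma mem_froots x p : froot x p \in froots x.
Proof. by rewrite froot_id (root_root (fconnect_sym (@perm_inj _ x))). Qed.

(** Since [z] permutes the [x]-cycles and [F] is constant on each, the factors are merely
    reordered. *)
Lemma prod_froots_commute x z (F : 'I_n -> algC) : commute x z ->
    (forall p, F (froot x p) = F p) ->
  \prod_(b in froots x) F (z b) = \prod_(b in froots x) F b.
Proof.
move=> /commute_sym/cent1P Cz FE; have Cz' : (z^-1)%g \in 'C[x]%g by rewrite groupV.
rewrite [RHS](reindex_onto (fun b => froot x (z b))
          (fun b => froot x (z^-1 b)%g)) /=; last first.
  by move=> b /eqP rb; rewrite froot_cent1 // permKV.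
under [RHS]eq_bigl => b do rewrite mem_froots froot_cent1 // permK /=.
by apply: eq_bigr => b _; rewrite FE.
Qed.

(* The base points [froot] of the two permutations are unrelated: the labels
   differ by a factor [delta] constant on cycles, which cancels in the product. *)
Lemma omega_fun_conj x z s : commute x z ->
  omega_fun zeta (x ^ s)%g (z ^ s)%g = omega_fun zeta x z.
Proof.
move=> cxz; have cxz' : commute (x ^ s)%g (z ^ s)%g.
  by rewrite /commute -!conjMg cxz.
rewrite !omega_fun_label //; set x' := (x ^ s)%g; set z' := (z ^ s)%g.
pose delta p := label x' (s p) / label x p.
have deltaE p : delta (froot x p) = delta p.
  rewrite -{2}(iter_cycle_pos x p) /delta -iter_conj !label_iter.
  rewrite card_porbit_conj -mulf_div divff ?mul1r //.
  rewrite expf_neq0 //; have := label_neq0 x (x (froot x p)).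
  rewrite (label_iter x _ 1) expr1 mulf_eq0.
  by case/norP.
rewrite (reindex_onto (fun b => froot x' (s b))
          (fun b => froot x (s^-1 b)%g)) /=; last first.
  move=> b /eqP rb; rewrite froot_conj permKV; exact: rb.
have fK b : froot x ((s^-1)%g (froot x' (s b))) = froot x b.
  by have := froot_conj x' s^-1%g (s b); rewrite permK conjgK.
under eq_bigl => b do rewrite mem_froots fK /=.
rewrite (eq_bigr (fun b => label x (z b) * (delta (z b) / delta b))); last first.
  move=> b /eqP rb; rewrite label_froot // permJ /delta.
  (* A base point has position 0 in its cycle. *)
  have -> : label x b = 1 by rewrite /label /cycle_pos rb findex0.
  by rewrite divr1 mulrA mulrCA divff ?label_neq0 // mulr1.
rewrite big_split /= -[RHS]mulr1; congr (_ * _).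
rewrite big_split /= prodfV (prod_froots_commute cxz) // divff //.
apply/prodf_neq0 => b _.
by rewrite mulf_neq0 ?invr_neq0 ?label_neq0.
Qed.

End Omega.

Lemma prod_natr_bool (R : comNzRingType) (I : finType) (Q a : pred I) :
  \prod_(i | Q i) (a i)%:R = [forall (i | Q i), a i]%:R :> R.
Proof.
have [/forall_inP aQ|/forall_inPn[i Qi /negPf ai]] := boolP [forall (i | Q i), a i].
  by rewrite big1 // => i /aQ->.
by rewrite (bigD1 i) //= ai mul0r.
Qed.

(** * Sign, fixed points and cycle lengths *)

Section Sign.

Variable n : nat.
Implicit Types (g : 'S_n) (c p : 'I_n).

Lemma froot_eq_porbit g c p :
  c \in froots g -> (froot g p == c) = (p \in porbit g c).
Proof.
rewrite froot_id => /eqP rc; rewrite -fconnect_porbit -{1}rc eq_sym.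
by rewrite (root_connect (fconnect_sym (@perm_inj _ g))).
Qed.

Lemma sum_card_froots g : (\sum_(c in froots g) #|porbit g c|)%N = n.
Proof.
rewrite -[RHS]card_ord -[RHS]sum1_card.
rewrite [RHS](partition_big (froot g) (mem (froots g))) /=; last first.
  by move=> p _; apply: mem_froots.
apply: eq_bigr => c rc; rewrite -[LHS]sum1_card; apply: eq_bigl => p.
by rewrite froot_eq_porbit.
Qed.

Lemma card_froots g : #|froots g| = #|porbits g|.
Proof.
rewrite -(card_in_imset (f := porbit g) (D := mem (froots g))); last first.
  move=> b c rb rc e; apply/eqP; move: (rb); rewrite froot_id => /eqP <-.
  by rewrite froot_eq_porbit // -e porbit_id.
apply: eq_card => A; apply/imsetP/imsetP=> [[c rc ->]|[c _ ->]].
  by exists c.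
by exists (froot g c); rewrite ?mem_froots ?porbit_froot.
Qed.

(** [odd_perm] is the parity of [n] plus the number of cycles, and the cycle lengths add up to
    [n]. *)
Lemma sign_prod_froots g :
  (-1) ^+ odd_perm g = \prod_(c in froots g) (-1) ^+ #|porbit g c|.+1 :> algC.
Proof.
rewrite -expr_sum -[LHS]signr_odd -[RHS]signr_odd; congr (_ ^+ _).
under eq_bigr => c _ do rewrite -addn1.
rewrite big_split /= sum_card_froots sum1_card card_froots.
by rewrite oddb oddD /odd_perm card_ord.
Qed.

Lemma card_porbit_eq1 g p : (#|porbit g p| == 1%N) = (g p == p).
Proof. by rewrite (eq_iter_dvd g p 1) dvdn1. Qed.

(** A power of 2 is even unless it is 1, so modulo 2 only the fixed points contribute to [n]. *)
Lemma odd_card_fixed g : (forall p, 2%N.-nat #|porbit g p|) ->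
  odd #|[set p | g p == p]| = odd n.
Proof.
move=> g2; rewrite -[in RHS](sum_card_froots g).
have odd2 p : odd #|porbit g p| = (g p == p).
  rewrite -card_porbit_eq1; have [k ->] := p_natP (g2 p).
  by rewrite oddX orbF -(eqn_exp2l (m := 2) k 0) ?expn0.
rewrite (bigID (fun c => g c == c)) /= oddD.
rewrite [X in _ (+) odd X](_ : _ = 2 * \sum_(c in froots g | g c != c) #|porbit g c| %/ 2)%N.
  rewrite oddM addbF; congr odd; rewrite -sum1_card.
  transitivity (\sum_(c | g c == c) 1)%N; first by apply: eq_bigl => c; rewrite inE.
  apply: eq_big => [c|c /eqP/eqP]; last by rewrite -card_porbit_eq1 => /eqP->.
  rewrite andbC; have [gc|//] := eqVneq (g c) c.
  have : froot g c \in porbit g c by rewrite -fconnect_porbit connect_root.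
  case/mem_porbitP=> k; rewrite froot_id => ->; apply/esym/eqP.
  by elim: k => //= k ->.
rewrite big_distrr /=; apply: eq_bigr => c /andP[_ gc].
by rewrite mulnC divnK // dvdn2 odd2.
Qed.

End Sign.

(** * Evaluation of the weighted sums over the centralizer *)

Section Evaluation.

Variables (n : nat) (zeta : nat -> algC).
Hypothesis zetaP : forall i, (0 < i)%N -> i.-primitive_root (zeta i).
Implicit Types (x g : 'S_n) (p q b c : 'I_n) (P : pred 'I_n).

Definition has_parity P x := [forall q, odd #|porbit x q| == P q].

Definition comp_const P x g :=
  [forall b, forall (q | same_comp x g b q), P q == P b].

Definition pow2_cycles g := [forall q, 2%N.-nat #|porbit g q|].

(** [x^j] and [g^k] commute with both permutations, hence preserve the lengths of their cycles. *)
Lemma card_porbit_comp x g b q : commute x g -> same_comp x g b q ->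
  #|porbit x q| = #|porbit x b| /\ #|porbit g q| = #|porbit g b|.
Proof.
move=> cxg /(same_compP _ _ cxg)[j [k ->]].
have cj : (x ^+ j)%g \in 'C[g]%g by rewrite groupX //; apply/cent1P.
have ck : (g ^+ k)%g \in 'C[x]%g by rewrite groupX //; apply/cent1P/commute_sym.
rewrite porbit_iter -[iter j x _]permX card_porbit_cent1 // porbit_iter.
by rewrite -permX card_porbit_cent1.
Qed.

Lemma comp_rootP x g q :
  exists2 b, b \in fingraph.roots (edge x g) & same_comp x g b q.
Proof.
exists (fingraph.root (edge x g) q).
  by rewrite unfold_in /= (root_root (same_comp_sym x g)).
by rewrite /same_comp same_comp_sym; apply: connect_root.
Qed.

(** The sign of the restriction of [g] to the component of [b]. *)
Definition comp_sign x g b : algC :=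
  \prod_(c in froots g | same_comp x g b c) (-1) ^+ #|porbit g c|.+1.

Lemma comp_signE x g b : commute x g ->
  comp_sign x g b = (-1) ^+ (#|porbit g b|.+1 * ret g x b).
Proof.
move=> cxg; rewrite /comp_sign.
rewrite (eq_bigr (fun=> (-1) ^+ #|porbit g b|.+1)); last first.
  by move=> c /andP[_ bc]; have [_ ->] := card_porbit_comp cxg bc.
under eq_bigl => c do rewrite same_compC.
rewrite (prod_component b (fun=> (-1) ^+ #|porbit g b|.+1) (commute_sym cxg)).
by rewrite prodr_const card_ord exprM.
Qed.

Lemma prod_comp_sign x g :
  \prod_(b in fingraph.roots (edge x g)) comp_sign x g b = (-1) ^+ odd_perm g.
Proof.
rewrite sign_prod_froots (prod_components g x).
apply: eq_big => [b|b _]; last by apply: eq_bigl => c; rewrite same_compC.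
by rewrite !unfold_in /fingraph.root (eq_pick (same_compC x g b)).
Qed.

(* The factors [comp_const] record that all points of a component have cycles of
   the same length, so that [P] must be constant on components. *)
Lemma sum_omega_parity P g :
  \sum_(x in 'C[g]%g) (has_parity P x)%:R * omega_fun zeta x g =
  \sum_(x in 'C[g]%g)
    [&& pow2_cycles g, comp_const P x g &
        has_parity (fun q => P q || (g q != q)) x]%:R *
    \prod_(b in fingraph.roots (edge x g)) (if P b then 1 else comp_sign x g b).
Proof.
(* [phi] and [phi'] are the contributions of one component to the two sides; their factor [cst] is
   invariant under twists and comes out of the averages. *)
pose cst x b := [forall (q | same_comp x g b q), P q == P b].
pose phi x b := (cst x b)%:R *
  ((odd #|porbit x b| == P b)%:R * local_weight zeta x g b).
pose phi' x b := (cst x b)%:R *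
  ((2%N.-nat #|porbit g b| &&
    (odd #|porbit x b| == P b || (#|porbit g b| != 1%N)))%:R
   * (if P b then 1 else comp_sign x g b)).
have cstE x m t b : cst (twist g m t x) b = cst x b.
  by apply: eq_forallb => q; rewrite same_comp_twist.
have csgE x m t b : comp_sign (twist g m t x) g b = comp_sign x g b.
  by apply: eq_bigl => c; rewrite same_comp_twist.
have cstC x b q : same_comp x g b q -> cst x b -> cst x q.
  move=> bq /forall_inP cb; apply/forall_inP=> r qr.
  by rewrite (eqP (cb _ bq)) cb //; apply: connect_trans qr.
transitivity (\sum_(x in 'C[g]%g)
    \prod_(b in fingraph.roots (edge x g)) phi x b).
  apply: eq_bigr => x /cent1P cxg.
  rewrite omega_fun_local // !big_split /= !prod_natr_bool mulrA -natrM mulnb.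
  congr ((nat_of_bool _)%:R * _); apply/forallP/andP=> [h|[/forall_inP h1 /forall_inP h2] q].
    split; apply/forall_inP=> b _; last exact: h.
    apply/forall_inP=> q bq; have [e _] := card_porbit_comp cxg bq.
    by rewrite -(eqP (h q)) -(eqP (h b)) e.
  have [b rb bq] := comp_rootP x g q.
  have [e _] := card_porbit_comp cxg bq.
  by rewrite e (eqP (h2 b rb)) eq_sym (forall_inP (h1 b rb)).
transitivity (\sum_(x in 'C[g]%g)
    \prod_(b in fingraph.roots (edge x g)) phi' x b); last first.
  apply: eq_bigr => x /cent1P cxg.
  rewrite !big_split /= !prod_natr_bool mulrA -natrM mulnb; congr ((nat_of_bool _)%:R * _).
  apply/andP/and3P=> [[/forall_inP h1 /forall_inP h2]|].
    split; apply/forallP=> q; have [b rb bq] := comp_rootP x g q;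
      have [ex eg] := card_porbit_comp cxg bq.
    - by rewrite eg; case/andP: (h2 b rb).
    - exact: cstC bq (h1 b rb).
    - rewrite ex -card_porbit_eq1 eg (eqP (forall_inP (h1 b rb) q bq)).
      by case/andP: (h2 b rb).
  case=> /forallP h1 /forallP h2 /forallP h3; split; apply/forall_inP=> b _.
    exact: h2.
  by rewrite h1 card_porbit_eq1 h3.
apply: sum_prod_components => [x m b t cxg mb|x m cxg].
  have it j := iter_twist_off t j mb.
  rewrite /phi /phi' cstE csgE (eq_porbit_iter it).
  by rewrite (eq_local_weight_iter it).
under eq_bigr => t _ do rewrite /phi cstE.
under [RHS]eq_bigr => t _ do rewrite /phi' cstE csgE comp_signE //.
rewrite -!mulr_sumr; congr (_ * _).
(* Where [P] asks for odd cycles the odd average applies; elsewhere the even one does, and it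
   supplies the sign. *)
case: (P m) => /=; first under eq_bigr => t _ do rewrite eqb_id.
  rewrite sum_odd_local_weight //; apply: eq_bigr => t _.
  by rewrite eqb_id mulr1.
under eq_bigr => t _ do rewrite eqbF_neg.
by rewrite sum_even_local_weight.
Qed.

Lemma sum_omega_odd g :
  \sum_(x in 'C[g]%g) (has_parity predT x)%:R * omega_fun zeta x g =
  (pow2_cycles g)%:R * \sum_(x in 'C[g]%g) (has_parity predT x)%:R.
Proof.
rewrite sum_omega_parity mulr_sumr; apply: eq_bigr => x _.
rewrite big1 // mulr1 -natrM mulnb; congr (_ && _)%:R.
have -> : comp_const predT x g by apply/forallP=> b; apply/forall_inP=> q _.
by [].
Qed.

(** By the hypothesis and [comp_const], a component where [P] holds consists of fixed points of [g]
    and has sign 1; restoring its factor [comp_sign] completes the product to the sign of [g]. *)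
Lemma sum_omega_mostly_even P g : (forall q, P q -> P (g q) -> g q = q) ->
  \sum_(x in 'C[g]%g) (has_parity P x)%:R * omega_fun zeta x g =
  (-1) ^+ odd_perm g * ((pow2_cycles g)%:R *
   \sum_(x in 'C[g]%g) (comp_const P x g &&
        has_parity (fun q => P q || (g q != q)) x)%:R).
Proof.
move=> Pg; rewrite sum_omega_parity !mulr_sumr; apply: eq_bigr => x /cent1P cxg.
rewrite mulrC -natrM mulnb.
have [/and3P[_ cP _]|_] := boolP [&& _, _ & _]; last by rewrite !mulr0.
rewrite !mulr1 -(prod_comp_sign x); apply: eq_bigr => b _.
have [Pb|//] := boolP (P b); rewrite comp_signE //.
have /eqP-> : #|porbit g b| == 1%N.
  rewrite card_porbit_eq1; apply/eqP/Pg => //.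
  have := forall_inP (forallP cP b) (g b) (same_comp_stepr x g b).
  by move/eqP->.
by rewrite exprM expr2 mulrNN mulr1 expr1n.
Qed.

End Evaluation.

(** * Counting permutations by the parities of their cycles *)

Section ParityCount.

Local Open Scope nat_scope.

Variable n : nat.
Implicit Types (x y g : 'S_n) (p q a r : 'I_n) (S A : {set 'I_n}).

Lemma porbit_sub_stable y A a :
  (forall r, r \in A -> y r \in A) -> a \in A -> porbit y a \subset A.
Proof.
move=> yA aA; apply/subsetP=> _ /mem_porbitP[k ->].
by elim: k => //= k IHk; apply: yA.
Qed.

Lemma mem_porbit_stepl y a r : r \in porbit y a -> y r \in porbit y a.
Proof. by rewrite mem_porbit_step. Qed.

Lemma porbit_fixed y p : y p = p -> porbit y p = [set p].
Proof.
move=> yp; apply/eqP; rewrite eqEsubset sub1set porbit_id andbT.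
by apply: porbit_sub_stable => [r|]; rewrite inE // => /eqP->; rewrite yp set11.
Qed.

(* [y * tperm p q] inserts the fixed point [p] of [y] just before [q]. *)
Section Insert.

Variables (y : 'S_n) (p q : 'I_n).
Hypotheses (yp : y p = p) (qp : q != p).

Let y' : 'S_n := (y * tperm p q)%g.

Let y'p : y' p = q.
Proof. by rewrite permM yp tpermL. Qed.

Let y_neq r : r != p -> y r != p.
Proof. by apply: contraNneq => e; apply/eqP/(@perm_inj _ y); rewrite e yp. Qed.

Let y'E r : r != p -> y' r = if y r == q then p else y r.
Proof.
move=> rp; rewrite permM; case: eqP => [->|/eqP yq]; first by rewrite tpermR.
by rewrite tpermD // eq_sym // y_neq.
Qed.

Lemma porbit_insert a : a != p ->
  porbit y' a = if q \in porbit y a then p |: porbit y a else porbit y a.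
Proof.
move=> ap.
have np r : r \in porbit y a -> r != p.
  by apply: contraTneq => ->; rewrite porbit_sym (porbit_fixed yp) inE.
have sub : porbit y a \subset porbit y' a.
  apply: (@subset_trans _ _ (porbit y' a :\ p)); last exact: subsetDl.
  apply: porbit_sub_stable => [r|]; last by rewrite !inE ap porbit_id.
  rewrite !inE => /andP[rp ra]; rewrite y_neq //=.
  have := mem_porbit_stepl ra; rewrite y'E //.
  by case: eqP => [->|//] /mem_porbit_stepl; rewrite y'p.
apply/eqP; rewrite eqEsubset; apply/andP; split.
  case: ifP => qa; apply: porbit_sub_stable; rewrite ?inE ?porbit_id ?orbT //.
    move=> r; rewrite !inE => /orP[/eqP->|ra]; first by rewrite y'p qa orbT.
    rewrite y'E ?np //; case: (y r =P q) => _; first by rewrite eqxx.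
    by rewrite mem_porbit_stepl ?orbT.
  move=> r ra; rewrite y'E ?np //; case: (y r =P q) => [e|_].
    by rewrite -e mem_porbit_stepl in qa.
  exact: mem_porbit_stepl.
case: ifP => qa //; rewrite subUset sub andbT sub1set.
by rewrite -mem_porbit_step y'p; apply: (subsetP sub).
Qed.

Lemma card_porbit_insert a : a != p ->
  #|porbit y' a| = #|porbit y a| + (q \in porbit y a).
Proof.
move=> ap; rewrite porbit_insert //; case: ifP; rewrite ?addn0 // => _.
by rewrite cardsU1 addnC (porbit_sym y p a) (porbit_fixed yp) inE ap.
Qed.

Lemma card_porbit_insert_new : #|porbit y' p| = #|porbit y q|.+1.
Proof.
rewrite -(porbit_iter y' p 1) /= y'p card_porbit_insert //.
by rewrite porbit_id addn1.
Qed.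

Lemma mem_porbit_insert a : a != p -> (p \in porbit y' a) = (q \in porbit y a).
Proof.
move=> ap; rewrite porbit_insert //; case: ifP => qa.
  by rewrite !inE eqxx.
by rewrite porbit_sym (porbit_fixed yp) inE (negPf ap).
Qed.

End Insert.

(** The index [q] is the image of [p]: right multiplication by [tperm p q] takes [p] out of its
    cycle, and [q = p] is the case where [p] is fixed. *)
Lemma sum_perm_on S p (F : 'S_n -> nat) : p \in S ->
  \sum_(y | perm_on S y) F y =
  \sum_(q in S) \sum_(y | perm_on (S :\ p) y) F (y * tperm p q)%g.
Proof.
move=> pS; rewrite (partition_big (fun y => y p) (mem S)) /=; last first.
  by move=> y yS; rewrite (perm_closed _ yS).
apply: eq_bigr => q qS.
have tS : perm_on S (tperm p q).
  by apply: subset_trans (tperm_on p q) _; rewrite subUset !sub1set pS.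
rewrite (reindex_inj (mulIg (tperm p q))) /=; apply: eq_bigl => y.
rewrite permM; apply/andP/idP=> [[yS /eqP ypq]|yS].
  have yp : y p = p by apply: (@perm_inj _ (tperm p q)); rewrite ypq tpermL.
  apply/subsetP=> r; rewrite inE => yr; rewrite !inE.
  have -> : r != p by apply: contraNneq yr => ->; rewrite yp.
  have := perm_onM yS tS; rewrite -mulgA tperm2 mulg1 => /subsetP-> //.
rewrite (out_perm yS) ?inE ?eqxx // tpermL; split=> //.
by apply: perm_onM tS; apply: subset_trans yS (subsetDl _ _).
Qed.

Lemma sum_perm_on0 (F : 'S_n -> nat) : \sum_(y | perm_on set0 y) F y = F 1%g.
Proof.
rewrite (big_pred1 1%g) // => y; apply/idP/eqP=> [y0|->]; last exact: perm_on1.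
by apply: perm_on_id y0 _; rewrite cards0.
Qed.

(** [P] may depend on the permutation, so that a condition can single out the cycle through a given
    point. *)
Definition parity_count S (P : 'S_n -> pred 'I_n) : nat :=
  \sum_(y | perm_on S y) [forall a in S, odd #|porbit y a| == P y a].

(** Taking [p] out of its cycle, the only one of parity opposite to [beta], leaves all cycles with
    parity [beta]. Conversely [p] can be inserted before any other point, or be fixed if [beta] is
    false. *)
Lemma parity_count_cycle (beta : bool) S p : p \in S ->
  parity_count S (fun y a => beta (+) (a \in porbit y p)) =
  (#|S :\ p| + ~~ beta) * parity_count (S :\ p) (fun _ _ => beta).
Proof.
move=> pS; rewrite /parity_count (sum_perm_on _ pS) (big_setD1 p) //=.
rewrite addnC mulnDl -sum_nat_const; congr (_ + _).
  apply: eq_bigr => q; rewrite !inE => /andP[qp qS]; apply: eq_bigr => y yS.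
  have yp : y p = p by apply: (out_perm yS); rewrite !inE eqxx.
  congr (nat_of_bool _); apply/forall_inP/forall_inP=> h a.
    rewrite !inE => /andP[ap aS]; have := h a aS.
    rewrite card_porbit_insert // (porbit_sym _ a p) mem_porbit_insert // oddD oddb.
    by rewrite (inj_eq (can_inj (addbK _))).
  move=> aS; have [->|ap] := eqVneq a p.
    rewrite card_porbit_insert_new // porbit_id /= addbT (inj_eq negb_inj).
    by apply: h; rewrite !inE qp.
  rewrite card_porbit_insert // (porbit_sym _ a p) mem_porbit_insert // oddD oddb.
  by rewrite (inj_eq (can_inj (addbK _))) h // !inE ap.
rewrite tperm1 big_distrr /=; apply: eq_bigr => y yS; rewrite mulg1 mulnb.
have yp : y p = p by apply: (out_perm yS); rewrite !inE eqxx.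
congr (nat_of_bool _); apply/forall_inP/andP=> [h|[nb /forall_inP h] a aS].
  split; first by have := h p pS; rewrite (porbit_fixed yp) cards1 inE eqxx; case: beta {h}.
  apply/forall_inP=> a; rewrite !inE => /andP[ap aS].
  by have := h a aS; rewrite (porbit_fixed yp) inE (negPf ap) addbF.
rewrite [porbit y p](porbit_fixed yp) inE; have [->|ap] := eqVneq a p.
  by rewrite (porbit_fixed yp) cards1; case: beta nb {h}.
by rewrite addbF h // !inE ap.
Qed.

(** A fixed [p] is an odd cycle, which requires [beta]; otherwise taking [p] out flips the parity of
    the cycle of its image [q] and of no other. *)
Lemma parity_count_rec (beta : bool) S p : p \in S ->
  parity_count S (fun _ _ => beta) =
  beta * parity_count (S :\ p) (fun _ _ => beta) +
  \sum_(q in S :\ p) parity_count (S :\ p) (fun y a => beta (+) (a \in porbit y q)).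
Proof.
move=> pS; rewrite /parity_count (sum_perm_on _ pS) (big_setD1 p) //=.
congr (_ + _).
  rewrite tperm1 big_distrr /=; apply: eq_bigr => y yS; rewrite mulg1 mulnb.
  have yp : y p = p by apply: (out_perm yS); rewrite !inE eqxx.
  congr (nat_of_bool _); apply/forall_inP/andP=> [h|[nb /forall_inP h] a aS].
    split; first by have := h p pS; rewrite (porbit_fixed yp) cards1; case: beta {h}.
    by apply/forall_inP=> a; rewrite !inE => /andP[ap aS]; apply: h.
  have [->|ap] := eqVneq a p.
    by rewrite (porbit_fixed yp) cards1; case: beta nb {h}.
  by rewrite h // !inE ap.
apply: eq_bigr => q; rewrite !inE => /andP[qp qS]; apply: eq_bigr => y yS.
have yp : y p = p by apply: (out_perm yS); rewrite !inE eqxx.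
have swap b c d : ((b (+) c) == d) = (b == d (+) c) by case: b; case: c; case: d.
congr (nat_of_bool _); apply/forall_inP/forall_inP=> h a.
  rewrite !inE => /andP[ap aS]; have := h a aS.
  by rewrite card_porbit_insert // oddD oddb swap (porbit_sym y a q).
move=> aS; have [->|ap] := eqVneq a p.
  rewrite card_porbit_insert_new //=; have := h q; rewrite !inE qp porbit_id addbT.
  by move=> /(_ qS) /eqP->; rewrite negbK.
by rewrite card_porbit_insert // oddD oddb swap (porbit_sym y q a) h // !inE ap.
Qed.

(** Together the two recursions give a second-order recursion in [#|S|] alone; the odd and even
    counts are then compared by an induction that advances two points at a time. *)
Lemma parity_countE S :
  if odd #|S| then
    parity_count S (fun _ _ => true) =
      \sum_(p in S) parity_count (S :\ p) (fun _ _ => false)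
  else parity_count S (fun _ _ => true) = parity_count S (fun _ _ => false).
Proof.
have [w [w0 w1 wS]] : exists w : bool -> nat -> nat,
    [/\ forall b, w b 0 = 1, forall b : bool, w b 1 = b &
    forall (b : bool) k, w b k.+2 = b * w b k.+1 + k.+1 * ((k + ~~ b) * w b k)].
  (* [w2 k] carries the values at [k] and [k.+1], since the recursion has order two. *)
  pose w2 (b : bool) := fix w2 k : nat * nat :=
    if k is k.+1 then
      let: (u, v) := w2 k in (v, b * v + k.+1 * ((k + ~~ b) * u))
    else (1, b : nat).
  exists (fun b k => (w2 b k).1); split=> // b k /=.
  by case: (w2 b k).
have wE b k : forall S, #|S| = k -> parity_count S (fun _ _ => b) = w b k.
  suff: (forall S, #|S| = k -> parity_count S (fun _ _ => b) = w b k) /\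
        (forall S, #|S| = k.+1 -> parity_count S (fun _ _ => b) = w b k.+1).
    by case.
  elim: k => [|k [IH0 IH1]].
    have c0 A : #|A| = 0 -> parity_count A (fun _ _ => b) = w b 0.
      move=> /eqP; rewrite cards_eq0 => /eqP->; rewrite /parity_count sum_perm_on0 w0.
      by case: forallP => // -[] a; rewrite inE.
    split=> // A /eqP/cards1P[p ->].
    rewrite (parity_count_rec b (set11 p)) setDv big_set0 addn0 c0 ?cards0 //.
    by rewrite w0 w1 muln1.
  split=> // A cA; have [p pA] : exists p, p \in A.
    by apply/card_gt0P; rewrite cA.
  have cAp : #|A :\ p| = k.+1 by apply/eqP; rewrite -eqSS -cA (cardsD1 p A) pA.
  rewrite (parity_count_rec b pA) wS IH1 //; congr (_ + _).
  rewrite -{1}cAp -sum_nat_const; apply: eq_bigr => q qA.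
  have cq : #|A :\ p :\ q| = k.
    by apply/eqP; rewrite -eqSS -cAp (cardsD1 q (A :\ p)) qA.
  by rewrite (parity_count_cycle b qA) cq IH0.
have w_double m : w true m.*2 = w false m.*2 /\
    w true m.*2.+1 = m.*2.+1 * w false m.*2.
  elim: m => [|m [IHe IHo]]; first by rewrite !w0 w1.
  have e2 : w true m.+1.*2 = w false m.+1.*2.
    rewrite doubleS !wS IHo IHe /= !mul0n add0n mul1n addn0 addn1; lia.
  split=> //; rewrite doubleS in e2 *.
  rewrite [w true _.+3]wS e2 IHo [w false _.+2]wS /=; nia.
case: ifP => oS.
  have [m Em] : exists m, #|S| = m.*2.+1.
    by exists #|S|./2; rewrite -[LHS]odd_double_half oS.
  rewrite (wE _ _ _ Em) (proj2 (w_double m)) -Em -sum_nat_const.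
  apply: eq_bigr => p pS; apply/esym/wE; apply/eqP.
  by rewrite -eqSS -Em (cardsD1 p S) pS.
have Em : #|S| = #|S|./2.*2 by rewrite -[LHS]odd_double_half oS.
by rewrite !(wE _ _ _ Em) (proj1 (w_double _)).
Qed.

(** Cycle length is constant along a cycle, so no other point of [S] can share the cycle of [p],
    which is therefore fixed. *)
Lemma parity_count_pred1 S p : p \in S ->
  parity_count S (fun _ a => a == p) = parity_count (S :\ p) (fun _ _ => false).
Proof.
move=> pS; rewrite /parity_count (sum_perm_on _ pS) (big_setD1 p) //=.
rewrite [X in _ + X]big1 ?addn0 => [|q].
  rewrite tperm1; apply: eq_bigr => y yS; rewrite mulg1.
  have yp : y p = p by apply: (out_perm yS); rewrite !inE eqxx.
  congr (nat_of_bool _); apply/forall_inP/forall_inP=> h a.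
    rewrite !inE => /andP[ap aS]; by rewrite (eqP (h a aS)) (negPf ap).
  move=> aS; have [->|ap] := eqVneq a p; first by rewrite (porbit_fixed yp) cards1.
  by apply: h; rewrite !inE ap.
rewrite !inE => /andP[qp qS]; apply: big1 => y yS.
have yp : y p = p by apply: (out_perm yS); rewrite !inE eqxx.
apply/eqP; rewrite eqb0; apply/negP=> /forall_inP h.
have := h q qS; rewrite card_porbit_insert // porbit_id addn1.
by rewrite -(card_porbit_insert_new yp qp) (eqP (h p pS)) eqxx (negPf qp).
Qed.

End ParityCount.

(** * Comparison of the counts on the fixed points of [g] *)

Section FixedPoints.

Local Open Scope nat_scope.

Variables (n : nat) (g : 'S_n).
Implicit Types (x y : 'S_n) (p q a : 'I_n) (P : pred 'I_n).

Let fix_g : {set 'I_n} := [set p | g p == p].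

Let fix_stable x p : x \in 'C[g]%g -> (x p \in fix_g) = (p \in fix_g).
Proof.
move/cent1P=> cxg; rewrite !inE -permM cxg permM.
by rewrite (inj_eq (@perm_inj _ x)).
Qed.

Let fix_iter x p k : x \in 'C[g]%g -> (iter k x p \in fix_g) = (p \in fix_g).
Proof. by move=> Cx; elim: k => //= k; rewrite fix_stable. Qed.

Let on_fix_cent y : perm_on fix_g y -> y \in 'C[g]%g.
Proof.
move=> yF; apply/cent1P/permP=> p; rewrite !permM.
have [pF|pF] := boolP (p \in fix_g).
  have := perm_closed p yF; rewrite pF inE => /eqP->.
  by move: pF; rewrite inE => /eqP->.
have gpF : g p \notin fix_g.
  by apply: contra pF; rewrite !inE (inj_eq (@perm_inj _ g)).
by rewrite (out_perm yF pF) (out_perm yF gpF).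
Qed.

(** Right multiplication by a permutation [y] of the fixed points preserves the centralizer and the
    cycles off these points, while on them [x * y] runs through all permutations. Double counting
    thus separates the two conditions. *)
Lemma sum_cent_parity P :
  #|fix_g|`! * \sum_(x in 'C[g]%g) has_parity (fun q => P q || (g q != q)) x =
  (\sum_(x in 'C[g]%g) [forall (a | a \notin fix_g), odd #|porbit x a|]) *
    parity_count fix_g (fun _ => P).
Proof.
pose h x : nat := has_parity (fun q => P q || (g q != q)) x.
rewrite -card_perm -sum_nat_const.
transitivity (\sum_(y | perm_on fix_g y) \sum_(x in 'C[g]%g) h (x * y)%g).
  apply: eq_bigr => y yF; rewrite (reindex_inj (mulIg y)) /=.
  by apply: eq_bigl => x; rewrite groupMr // on_fix_cent.
rewrite exchange_big big_distrl /=; apply: eq_bigr => x Cx.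
pose xF := restr_perm fix_g x.
have xN : x \in 'N(fix_g | 'P)%g.
  rewrite inE; apply/andP; split; first by rewrite inE.
  by rewrite inE; apply/subsetP=> q qF; rewrite inE /= apermE fix_stable.
have xFE a : a \in fix_g -> xF a = x a by move=> aF; apply: restr_permE.
have xF_on : perm_on fix_g xF by apply: restr_perm_on.
have onE y : perm_on fix_g (xF * y)%g = perm_on fix_g y.
  apply/idP/idP=> yF; last exact: perm_onM.
  by rewrite -(mulKg xF y); apply: perm_onM => //; apply: perm_onV.
rewrite /parity_count [RHS]big_distrr /= [RHS](reindex_inj (mulgI xF)) /=.
apply: eq_big => [y|y yF]; first by rewrite onE.
have xy_off a : a \notin fix_g -> porbit (x * y)%g a = porbit x a.
  move=> aF; apply: eq_porbit_iter; elim=> //= k ->.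
  by rewrite permM (out_perm yF) // fix_stable // fix_iter.
have xy_on a : a \in fix_g -> porbit (x * y)%g a = porbit (xF * y)%g a.
  move=> aF; apply: eq_porbit_iter => k.
  suff [-> //] : iter k (x * y)%g a = iter k (xF * y)%g a /\
                 iter k (xF * y)%g a \in fix_g.
  elim: k => //= k [-> kF]; rewrite !permM xFE //; split=> //.
  by rewrite (perm_closed _ yF) fix_stable.
rewrite mulnb; congr (nat_of_bool _); apply/forallP/andP=> [H|[/forall_inP H1 /forall_inP H2] a].
  split; apply/forall_inP=> a aF.
    rewrite -xy_off // (eqP (H a)); move: aF; rewrite inE => ->.
    by rewrite orbT.
  by rewrite -xy_on // (eqP (H a)); move: aF; rewrite inE => ->; rewrite orbF.
have [aF|aF] := boolP (a \in fix_g).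
  by rewrite xy_on // (eqP (H2 a aF)); move: aF; rewrite inE => ->; rewrite orbF.
by rewrite xy_off // H1 //; move: aF; rewrite inE => ->; rewrite orbT.
Qed.

Lemma sum_cent_even : pow2_cycles g -> ~~ odd n ->
  \sum_(x in 'C[g]%g) has_parity predT x =
  \sum_(x in 'C[g]%g)
    (comp_const pred0 x g && has_parity (fun q => pred0 q || (g q != q)) x).
Proof.
move=> /forallP g2 en; have := odd_card_fixed g2; rewrite (negPf en) => eF.
transitivity (\sum_(x in 'C[g]%g) has_parity (fun q => pred0 q || (g q != q)) x);
  last first.
  apply: eq_bigr => x _; rewrite [comp_const _ _ _](_ : _ = true) //.
  by apply/forallP=> b; apply/forall_inP.
apply/eqP; rewrite -(eqn_pmul2l (fact_gt0 #|fix_g|)) sum_cent_parity.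
rewrite (sum_cent_parity predT).
by have := parity_countE fix_g; rewrite eF => ->.
Qed.

Lemma sum_cent_odd : pow2_cycles g -> odd n ->
  \sum_(x in 'C[g]%g) has_parity predT x =
  \sum_(p : 'I_n) \sum_(x in 'C[g]%g)
    (comp_const (pred1 p) x g && has_parity (fun q => pred1 p q || (g q != q)) x).
Proof.
move=> /forallP g2 on; have := odd_card_fixed g2; rewrite on => oF.
(* Points moved by [g] contribute nothing, as [comp_const] would give [g p = p]. *)
rewrite [RHS](bigID (mem fix_g)) /= [X in _ + X]big1 => [|p].
  rewrite addn0; apply/eqP; rewrite -(eqn_pmul2l (fact_gt0 #|fix_g|)).
  rewrite (sum_cent_parity predT); have := parity_countE fix_g; rewrite oF => ->.
  rewrite !big_distrr /=; apply/eqP/eq_bigr => p pF.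
  rewrite -parity_count_pred1 // -(sum_cent_parity (pred1 p)); congr (_ * _).
  apply: eq_bigr => x /cent1P cxg; congr (nat_of_bool _).
  apply/idP/andP=> [H|[]//]; split=> //.
  have gp : g p = p by apply/eqP; move: pF; rewrite inE.
  (* Such a [q] is fixed by [g] and lies on the odd [x]-cycle of [p], so the parity condition at [q]
     forces [q = p]; [comp_const] is then automatic. *)
  have only q : same_comp x g p q -> q = p.
    case/(same_compP _ _ cxg)=> j [k].
    have -> : iter k g p = p by elim: k => //= k ->.
    move=> qE; apply/eqP.
    have gq : g q = q by rewrite qE; have /= -> := iter_iterC p 1 j cxg; rewrite gp.
    have := forallP H q; rewrite qE porbit_iter -qE (eqP (forallP H p)) /=.
    by rewrite gq !eqxx /= orbF => /eqP.
  apply/forallP=> b; apply/forall_inP=> q bq /=; apply/eqP; apply/eqP/eqP.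
    by move=> qp; apply: only; rewrite /same_comp same_comp_sym -qp.
  by move=> bp; apply: only; rewrite -bp.
rewrite inE => gp; apply: big1 => x _; apply/eqP; rewrite eqb0 negb_and.
apply/orP; left; apply/negP=> /forallP/(_ p)/forall_inP/(_ (g p)).
by move=> /(_ (same_comp_stepr x g p)) /=; rewrite eqxx (negPf gp).
Qed.

End FixedPoints.

(** * Cycle types, conjugacy, and membership in [OP] and [EP] *)

Section CycleType.

Local Open Scope nat_scope.

Variable n : nat.
Implicit Types (x y s : 'S_n) (p q b : 'I_n).

Lemma perm_cycle_type x :
  perm_eq (cycle_type x) [seq #|porbit x b| | b <- enum (froots x)].
Proof.
rewrite perm_sort (map_comp (fun A : {set 'I_n} => #|A|) (porbit x)).
apply/perm_map/uniq_perm; first exact: enum_uniq.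
  rewrite map_inj_in_uniq ?enum_uniq // => b c; rewrite !mem_enum => rb rc e.
  apply/eqP; move: (rb); rewrite froot_id => /eqP <-.
  by rewrite froot_eq_porbit // -e porbit_id.
move=> A; rewrite mem_enum; apply/imsetP/mapP=> [[p _ ->]|[b _ ->]].
  by exists (froot x p); rewrite ?mem_enum ?mem_froots ?porbit_froot.
by exists b.
Qed.

Let geq_trans : transitive geq.
Proof. by move=> a b c /= ab bc; apply: leq_trans bc ab. Qed.
Let geq_anti : antisymmetric geq.
Proof. by move=> a b /=; rewrite andbC -eqn_leq => /eqP. Qed.
Let geq_total : total geq.
Proof. by move=> a b; apply: leq_total. Qed.

Lemma cycle_type_conj x s : cycle_type (x ^ s)%g = cycle_type x.
Proof.
apply/(perm_sortP geq_total geq_trans geq_anti).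
have -> : [seq #|A| | A : {set 'I_n} in porbits x] =
    map (fun A : {set 'I_n} => #|A|)
      [seq [set s q | q in A] | A : {set 'I_n} in porbits x].
  by rewrite -map_comp; apply: eq_map => A /=; rewrite card_imset //; apply: perm_inj.
have porbitJ p : porbit (x ^ s)%g (s p) = [set s q | q in porbit x p].
  apply/setP=> q; apply/mem_porbitP/imsetP=> [[k ->]|[_ /mem_porbitP[k ->] ->]].
    by exists (iter k x p); rewrite ?mem_porbit_iter ?iter_conj.
  by exists k; rewrite iter_conj.
apply/perm_map/uniq_perm; first exact: enum_uniq.
  by rewrite map_inj_uniq ?enum_uniq //; apply/imset_inj/perm_inj.
move=> A; rewrite mem_enum; apply/imsetP/mapP=> [[p _ ->]|[B]].
  exists (porbit x (s^-1 p)%g); first by rewrite mem_enum; apply/imsetP; exists (s^-1 p)%g.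
  by rewrite -porbitJ permKV.
rewrite mem_enum => /imsetP[p _ ->] ->; exists (s p) => //.
Qed.

(** Base points of equal rank in the lists sorted by cycle length are matched by [f], and the
    matching is extended along cycles by sending [x^t b] to [y^t (f b)]. *)
Lemma cycle_type_eq_conj x y : cycle_type x = cycle_type y ->
  exists s, y = (x ^ s)%g.
Proof.
move=> xy.
pose L z := sort (relpre (fun b => #|porbit z b|) geq) (enum (froots z)).
have LE z : map (fun b => #|porbit z b|) (L z) = cycle_type z.
  rewrite -sort_map; apply/(perm_sortP geq_total geq_trans geq_anti).
  by rewrite perm_sym -(perm_sort geq); apply: perm_cycle_type.
have Lmem z b : (b \in L z) = (b \in froots z) by rewrite mem_sort mem_enum.
have Luniq z : uniq (L z) by rewrite sort_uniq enum_uniq.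
have Lxy : map (fun b => #|porbit x b|) (L x) = map (fun b => #|porbit y b|) (L y).
  by rewrite !LE.
have Lsz : size (L x) = size (L y).
  by rewrite -(size_map (fun b => #|porbit x b|)) Lxy size_map.
pose f b := nth b (L y) (index b (L x)).
have f_lt b : b \in froots x -> index b (L x) < size (L y).
  by rewrite -Lsz index_mem Lmem.
have f_root b : b \in froots x -> f b \in froots y.
  by move=> rb; rewrite -Lmem mem_nth // f_lt.
have f_inj : {in froots x &, injective f}.
  move=> b c rb rc; rewrite /f [nth c _ _](set_nth_default b) ?f_lt // => /eqP.
  rewrite nth_uniq ?f_lt // => /eqP e.
  by rewrite -(nth_index b (_ : b \in L x)) ?Lmem // e nth_index ?Lmem.
have f_card b : b \in froots x -> #|porbit y (f b)| = #|porbit x b|.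
  move=> rb; rewrite -(nth_map b 0 (fun b => #|porbit y b|)) ?f_lt // -Lxy.
  by rewrite (nth_map b) ?Lsz ?f_lt // nth_index ?Lmem.
pose h p := iter (cycle_pos x p) y (f (froot x p)).
have frootK p : froot x (froot x p) = froot x p by apply/eqP/mem_froots.
have h_froot p : froot y (h p) = f (froot x p).
  by rewrite /h froot_iter; apply/eqP/f_root/mem_froots.
have pos_lt p : cycle_pos x p < #|porbit x p|.
  rewrite -porbit_froot -order_porbit; apply: findex_max.
  by rewrite (fconnect_sym (@perm_inj _ x)) connect_root.
have h_inj : injective h.
  move=> p q e; have fpq : froot x p = froot x q.
    by apply: f_inj; rewrite ?mem_froots // -!h_froot e.
  rewrite -(iter_cycle_pos x p) -(iter_cycle_pos x q) fpq; congr iter.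
  move/eqP: e; rewrite /h fpq eq_iter_mod f_card ?mem_froots // porbit_froot.
  have pq : porbit x p = porbit x q by rewrite -porbit_froot fpq porbit_froot.
  by rewrite !modn_small // -?pq // => /eqP.
have posS p : cycle_pos x (x p) = (cycle_pos x p).+1 %% #|porbit x p|.
  rewrite {1}/cycle_pos (froot_iter x 1 p).
  have -> : x p = iter (cycle_pos x p).+1 x (froot x p).
    by rewrite iterS iter_cycle_pos.
  by rewrite findex_iter_mod porbit_froot.
exists (perm h_inj); apply/permP=> q.
rewrite -[q](permKV (perm h_inj)); move: ((perm h_inj)^-1 q)%g => p.
rewrite permJ !permE /h posS (froot_iter x 1) -iterS; apply/eqP.
by rewrite eq_iter_mod f_card ?mem_froots // porbit_froot modn_mod.
Qed.

Lemma sumn_cycle_type x : sumn (cycle_type x) = n.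
Proof.
rewrite (perm_sumn (perm_cycle_type x)) sumnE big_map big_enum /=.
exact: sum_card_froots.
Qed.

Lemma exists_intpart_cycle_type x : exists lam : intpart n, parts lam = cycle_type x.
Proof.
have ct0 : 0 \notin cycle_type x.
  rewrite (perm_mem (perm_cycle_type x)); apply/mapP=> -[b _ /esym/eqP].
  by rewrite (negPf (card_porbit_neq0 _ _)).
have ct_le k : k \in cycle_type x -> k < n.+1.
  rewrite (perm_mem (perm_cycle_type x)) => /mapP[b _ ->].
  by rewrite ltnS -[X in _ <= X]card_ord max_card.
have sz : size (map (@inord n) (cycle_type x)) <= n.
  rewrite size_map (perm_size (perm_cycle_type x)) size_map -cardE.
  by rewrite -[X in _ <= X]card_ord max_card.
have valE : map val (Bseq sz) = cycle_type x.
  rewrite /= -map_comp -[RHS]map_id; apply/eq_in_map => k /ct_le kn /=.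
  by rewrite inordK.
have ok : is_intpart n (map val (Bseq sz)).
  rewrite valE /is_intpart ct0 sumn_cycle_type eqxx !andbT.
  exact: sort_sorted.
by exists (exist _ (Bseq sz) ok).
Qed.

Lemma parts_inj : injective (@parts n).
Proof.
by move=> l1 l2 /(inj_map val_inj) /val_inj /val_inj.
Qed.

Lemma all_cycle_type (a : pred nat) x :
  all a (cycle_type x) = [forall p, a #|porbit x p|].
Proof.
rewrite (perm_all _ (perm_cycle_type x)) all_map; apply/allP/forallP=> H p.
  by rewrite -porbit_froot; apply: H; rewrite mem_enum mem_froots.
by move=> _; apply: H.
Qed.

Lemma OP_cycle_type x lam : parts lam = cycle_type x ->
  (lam \in OP n) = has_parity predT x.
Proof.
by move=> lx; rewrite inE lx all_cycle_type; apply: eq_forallb => p; rewrite eqb_id.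
Qed.

Lemma EP_cycle_type_even x lam : ~~ odd n -> parts lam = cycle_type x ->
  (lam \in EP n) = has_parity pred0 x.
Proof.
move=> /negPf en lx; rewrite inE en lx all_cycle_type.
by apply: eq_forallb => p; rewrite eqbF_neg.
Qed.

(** A single part 1 comes from a unique fixed point [p]. Conversely [has_parity (pred1 p) x] makes
    [p] the only fixed point of [x], so at most one term of the sum is nonzero. *)
Lemma EP_cycle_type_odd x lam : odd n -> parts lam = cycle_type x ->
  (lam \in EP n : nat) = \sum_p has_parity (pred1 p) x.
Proof.
move=> on lx; rewrite inE on lx all_cycle_type.
have count1 : count_mem 1 (cycle_type x) = #|[set p | x p == p]|.
  rewrite (seq.permP (perm_cycle_type x)) count_map -size_filter cardE.
  apply/perm_size/uniq_perm=> [||p]; [|exact: enum_uniq|].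
    exact/filter_uniq/enum_uniq.
  rewrite mem_filter !mem_enum inE /= card_porbit_eq1.
  have [xp|xp] := eqVneq (x p) p; last by rewrite [RHS]inE (negPf xp).
  have : froot x p \in porbit x p by rewrite -fconnect_porbit connect_root.
  by rewrite porbit_fixed // inE -froot_id => ->; rewrite [RHS]inE xp eqxx.
(* [x p] lies on the same odd cycle as [p], and [p] is the only point allowed on an odd cycle. *)
have parity1 p : has_parity (pred1 p) x -> x p = p.
  move=> /forallP H; have := H (x p); rewrite (porbit_iter x p 1).
  by rewrite (eqP (H p)) /= eqxx eq_sym eqb_id => /eqP.
rewrite count1; case: andP => [[/cards1P[p pE] /forallP H]|H].
  have fixE q : (x q == q) = (q == p) by move/setP/(_ q): pE; rewrite !inE.
  rewrite (bigD1 p) //= big1 => [|q qp]; last first.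
    apply/eqP; rewrite eqb0; apply: contra qp => /parity1 xq.
    by rewrite -fixE xq.
  rewrite addn0 [has_parity _ _](_ : _ = true) //; apply/forallP=> q /=.
  have [->|qp] := eqVneq q p; first by rewrite porbit_fixed ?cards1 //; apply/eqP; rewrite fixE.
  by have := H q; rewrite card_porbit_eq1 fixE (negPf qp) eqbF_neg.
apply/esym/big1 => p _; apply/eqP; rewrite eqb0; apply/negP=> Hp; apply: H.
have xp := parity1 p Hp; split.
  apply/cards1P; exists p; apply/setP=> q; rewrite !inE.
  apply/eqP/eqP=> [xq|->//].
  by have := forallP Hp q; rewrite porbit_fixed // cards1 => /eqP/esym/eqP.
apply/forallP=> q; rewrite card_porbit_eq1.
have [->|qp] := eqVneq q p; first by rewrite xp eqxx.
by rewrite (eqP (forallP Hp q)) /= qp orbT.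
Qed.

End CycleType.

(** * Higher Lie characters as sums over centralizers *)

Section HigherLie.

Variables (n : nat) (zeta : nat -> algC).
Hypothesis zetaP : forall i, (0 < i)%N -> i.-primitive_root (zeta i).
Implicit Types (x y g s : 'S_n) (lam : intpart n).

Lemma cent1_conj x y : (y \in 'C[x]%g) = (x ^ y == x)%g.
Proof.
apply/cent1P/eqP=> [cyx|e]; first by apply: (mulgI y); rewrite -conjgC cyx.
by rewrite /commute [RHS]conjgC e.
Qed.

Lemma sum_conj x0 (F : 'S_n -> algC) :
  \sum_y F (x0 ^ y)%g = #|'C[x0]%g|%:R * \sum_(x in (x0 ^: setT)%g) F x.
Proof.
rewrite (partition_big (fun y => x0 ^ y)%g (mem (x0 ^: setT)%g)) /=; last first.
  by move=> y _; rewrite memJ_class ?inE.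
rewrite mulr_sumr; apply: eq_bigr => _ /imsetP[s _ ->].
rewrite (eq_bigr (fun=> F (x0 ^ s)%g)) => [|y /eqP-> //].
rewrite sumr_const mulr_natl -(card_rcoset 'C[x0]%G s); congr (_ *+ _).
apply: eq_card => y; rewrite mem_rcoset cent1_conj unfold_in /=.
by rewrite conjgM (can2_eq (conjgKV s) (conjgK s)).
Qed.

(** In the formula for an induced character, conjugation is moved from [g] to the representative
    [x0]; by orbit-stabilizer the sum then runs over the conjugates of [x0], that is, over a whole
    cycle type. *)
Lemma higher_LieE lam g :
  higher_Lie zetaP lam g =
  \sum_(x in 'C[g]%g | cycle_type x == parts lam) omega_fun zeta x g.
Proof.
rewrite /higher_Lie; set x0 := perm_of_type lam.
have ct0 : cycle_type x0 = parts lam.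
  exact/eqP/(xchooseP (cycle_type_exists lam)).
pose F x := omega_fun zeta x g *+ (x \in 'C[g]%g).
rewrite cfIndE ?subsetT //.
have -> : \sum_(y in [set: 'S_n]) omega zetaP x0 (g ^ y)%g
        = \sum_y F (x0 ^ y)%g.
  rewrite [RHS](reindex_inj invg_inj); apply: eq_big => [y|y _]; first by rewrite inE.
  rewrite /omega cfunElock /F.
  have -> : (g ^ y)%g \in 'C[x0]%g = (x0 ^ y^-1 \in 'C[g])%g.
    apply/cent1P/cent1P=> c.
      apply: (conjg_inj y); rewrite conjMg [in RHS]conjMg conjgKV; exact/esym.
    by rewrite -[x0](conjgKV y) /commute -!conjMg c.
  have [Cg|_] := boolP (x0 ^ y^-1 \in 'C[g])%g => //=.
  rewrite mulr1n -{1}(conjgKV y x0) omega_fun_conj //.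
  exact/cent1P.
rewrite sum_conj mulKf ?pnatr_eq0 -?lt0n ?cardG_gt0 //.
rewrite (big_mkcondr _ _ _ _) /= big_mkcond [RHS]big_mkcond /=; apply: eq_bigr => x _.
have -> : (x \in x0 ^: setT)%g = (cycle_type x == parts lam).
  apply/imsetP/eqP=> [[s _ ->]|xt]; first by rewrite cycle_type_conj.
  have [|s ->] := @cycle_type_eq_conj _ x0 x; first by rewrite ct0.
  by exists s; rewrite ?inE.
by rewrite /F; case: (x \in _); case: (_ == _).
Qed.

(** The cycle type of each [x] is given by exactly one partition, so exchanging the sums leaves the
    indicator [w] of the family. *)
Lemma sum_higher_Lie (A : {set intpart n}) g (w : 'S_n -> algC) :
    (forall lam x, parts lam = cycle_type x -> (lam \in A)%:R = w x) ->
  \sum_(lam in A) higher_Lie zetaP lam g =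
  \sum_(x in 'C[g]%g) w x * omega_fun zeta x g.
Proof.
move=> wA; rewrite (eq_bigr _ (fun lam _ => higher_LieE lam g)).
rewrite (exchange_big_dep (mem 'C[g]%g)) /=; last by move=> lam x _ /andP[].
apply: eq_bigr => x Cx; have [lam0 lam0E] := exists_intpart_cycle_type x.
rewrite -(wA _ _ lam0E) (eq_bigl (fun lam => (lam0 \in A) && (lam == lam0))).
  case: (lam0 \in A) => /=; last by rewrite big_pred0_eq mul0r.
  by rewrite big_pred1_eq mul1r.
move=> lam; rewrite Cx /= -lam0E (inj_eq (@parts_inj n)) eq_sym.
by have [->|_] := eqVneq lam lam0; rewrite ?andbT ?andbF.
Qed.

End HigherLie.

Theorem theorem1p2 (n : nat) (n_gt0 : (0 < n)%N) (zeta : nat -> algC)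
    (zetaP : forall i : nat, (0 < i)%N -> i.-primitive_root (zeta i)) :
  \sum_(lam in OP n) higher_Lie zetaP lam =
    sign_cf n * \sum_(lam in EP n) higher_Lie zetaP lam.
Proof.
apply/cfunP=> g; rewrite cfunE !sum_cfunE.
have -> : sign_cf n g = (-1) ^+ odd_perm g by rewrite cfunElock.
rewrite (@sum_higher_Lie _ _ zetaP _ g (fun x => (has_parity predT x)%:R)); last first.
  by move=> lam x /OP_cycle_type->.
rewrite sum_omega_odd //.
(* The sign extracted from the [EP] side cancels against the sign character. *)
have signK (c : algC) : (-1) ^+ odd_perm g * ((-1) ^+ odd_perm g * c) = c.
  by rewrite mulrA -expr2 sqrr_sign mul1r.
have [on|en] := boolP (odd n); last first.
  rewrite (@sum_higher_Lie _ _ zetaP _ g (fun x => (has_parity pred0 x)%:R)).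
    rewrite sum_omega_mostly_even // signK.
    (* Both sides vanish if some cycle length of [g] is not a power of 2. *)
    have [g2|] := boolP (pow2_cycles g); last by rewrite !mul0r.
    by congr (_ * _); rewrite -!natr_sum sum_cent_even.
  by move=> lam x /(EP_cycle_type_even en)->.
rewrite (@sum_higher_Lie _ _ zetaP _ g
          (fun x => \sum_p (has_parity (pred1 p) x)%:R)); last first.
  by move=> lam x /(EP_cycle_type_odd on)->; rewrite natr_sum.
have pred1P p q : pred1 p q -> pred1 p (g q) -> g q = q.
  by move=> /eqP-> /eqP.
(* For [n] odd, the sum is split according to the point [p] that carries the part 1. *)
rewrite [X in _ = _ * X](eq_bigr (fun x =>
    \sum_p (has_parity (pred1 p) x)%:R * omega_fun zeta x g)); last first.
  by move=> x _; rewrite mulr_suml.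
rewrite [X in _ = _ * X]exchange_big /=.
rewrite [X in _ = _ * X](eq_bigr _
  (fun p _ => sum_omega_mostly_even zetaP (pred1P p))).
rewrite -mulr_sumr signK -mulr_sumr.
have [g2|] := boolP (pow2_cycles g); last by rewrite !mul0r.
congr (_ * _); rewrite -natr_sum sum_cent_odd // natr_sum.
by apply: eq_bigr => p _; rewrite natr_sum.
Qed.
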